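(* Suppose $p:\mathbb{E}\to\mathbb{B}$ is a fibred category satisfying the following conditions. \begin{enumerate} \item The base category $\mathbb{B}$ and all fibers $\mathbb{E}_I$ are type-theoretic fibration categories. \item For every morphism $s:I\to J$ in $\mathbb{B}$, the reindexing functor $s^*:\mathbb{E}_J\to\mathbb{E}_I$ is a type-theoretic functor. \item For every acyclic cofibration $s:I\to J$ in $\mathbb{B}$, every fibration in $\mathbb{E}_J$ is weakly $s^*$-cartesian. \item For any fibration $s:I\to J$ in $\mathbb{B}$, the reindexing functor $s^*:\mathbb{E}_J\to\mathbb{E}_I$ has a right adjoint $s_*$ preserving fibrations. Moreover, the Beck-Chevalley condition holds: if $s':I'\to J'$ is the pullback of a fibration $s:I\to J$ along $r:J'\to J$, with upper morphism $t:I'\to I$ (so $s\circ t=r\circ s'$), then the canonical natural transformation $r^*s_*\Rightarrow s'_*t^*$ is an isomorphism. \end{enumerate} Then $\mathbb{E}$ has a structure of type-theoretic fibration category whose fibrations are the Reedy fibrations, and $p$ is a fibred type-theoretic fibration category.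
   Context: A morphism $i:A\to B$ has the left lifting property with respect to $q:C\to D$ if for all $f:A\to C$, $g:B\to D$ with $qf=gi$ there is $h:B\to C$ with $hi=f$ and $qh=g$. A type-theoretic fibration category is a category $\mathbb{C}$ with a terminal object $1$ and a subcategory whose morphisms are called fibrations, such that (an acyclic cofibration being a morphism with the left lifting property with respect to all fibrations): (i) all isomorphisms and all morphisms with codomain $1$ are fibrations; (ii) pullbacks of fibrations along arbitrary morphisms exist and are fibrations; (iii) every morphism factors as an acyclic cofibration followed by a fibration; (iv) for any fibrations $f:A\to B$ and $g:B\to C$ there is a fibration $\Pi_gf:\Pi_gA\to C$, called a dependent product of $f$ along $g$, with a natural bijection $(\mathbb{C}/C)(h,\Pi_gf)\cong(\mathbb{C}/B)(g^*h,f)$ for all $h:X\to C$. A type-theoretic functor is a functor between type-theoretic fibration categories preserving terminal objects, fibrations, pullbacks of fibrations, acyclic cofibrations and dependent products. A fibred category $p:\mathbb{E}\to\mathbb{B}$ is a Grothendieck fibration; $\mathbb{E}_I$ is the fiber over $I$, and a morphism $f$ is above $s$ if $pf=s$. For a functor $q:\mathbb{C}\to\mathbb{D}$, a morphism $f:A\to B$ of $\mathbb{C}$ is weakly $q$-cartesian if for all $g:X\to B$ in $\mathbb{C}$ and $s:qX\to qA$ with $qf\circ s=qg$ there exists $h:X\to A$ with $f\circ h=g$ and $qh=s$. A morphism $f:A\to B$ in $\mathbb{E}$ is a Reedy fibration if $pf$ is a fibration in $\mathbb{B}$ and the induced morphism $A\to(pf)^*B$ is a fibration in $\mathbb{E}_{pA}$.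 A fibred type-theoretic fibration category is a fibred category $p:\mathbb{E}\to\mathbb{B}$ such that: (1) $\mathbb{E}$ and $\mathbb{B}$ are type-theoretic fibration categories and $p$ is a type-theoretic functor; (2) every cartesian morphism above a fibration is a fibration; (3) if $g:A\to C$ is a fibration in $\mathbb{E}$, $pg=t\circ s$ with $s:pA\to J$ a fibration and $t:J\to pC$, then the induced morphism $A\to t^*C$ above $s$ is a fibration; (4) every cartesian morphism above an acyclic cofibration is an acyclic cofibration. *)

(* Defs.v *)
From Stdlib Require Import ProofIrrelevance IndefiniteDescription.

Set Implicit Arguments.
Unset Strict Implicit.
Unset Printing Implicit Defensive.

Declare Scope cat_scope.
Delimit Scope cat_scope with cat.
Open Scope cat_scope.

Record category := Category {
  ob :> Type;
  hom : ob -> ob -> Type;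
  idm : forall A, hom A A;
  comp : forall A B C, hom B C -> hom A B -> hom A C;
  comp_assoc : forall A B C D (h : hom C D) (g : hom B C) (f : hom A B),
    comp h (comp g f) = comp (comp h g) f;
  comp_idl : forall A B (f : hom A B), comp (idm B) f = f;
  comp_idr : forall A B (f : hom A B), comp f (idm A) = f
}.

Arguments hom {_} _ _.
Arguments idm {_} _.
Arguments comp {_ _ _ _} _ _.
Arguments comp_assoc {_ _ _ _ _} _ _ _.
Arguments comp_idl {_ _ _} _.
Arguments comp_idr {_ _ _} _.

Notation "A ~> B" := (hom A B) (at level 70, no associativity) : cat_scope.
Notation "g ∘ f" := (comp g f) (at level 40, left associativity) : cat_scope.

Record functor (C D : category) := Functor {
  fob :> C -> D;
  fmap : forall A B : C, A ~> B -> fob A ~> fob B;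
  fmap_id : forall A : C, fmap (idm A) = idm (fob A);
  fmap_comp : forall (X Y Z : C) (g : Y ~> Z) (f : X ~> Y),
    fmap (g ∘ f) = fmap g ∘ fmap f
}.

Arguments fmap {_ _} _ {_ _} _.

Record right_adjoint (C D : category) (F : functor C D) := RightAdjoint {
  ra_functor :> functor D C;
  ra_unit : forall X : C, X ~> ra_functor (F X);
  ra_counit : forall Y : D, F (ra_functor Y) ~> Y;
  ra_unit_nat : forall (X X' : C) (f : X ~> X'),
    ra_unit X' ∘ f = fmap ra_functor (fmap F f) ∘ ra_unit X;
  ra_counit_nat : forall (Y Y' : D) (g : Y ~> Y'),
    ra_counit Y' ∘ fmap F (fmap ra_functor g) = g ∘ ra_counit Y;
  ra_triangle_l : forall X : C, ra_counit (F X) ∘ fmap F (ra_unit X) = idm (F X);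
  ra_triangle_r : forall Y : D,
    fmap ra_functor (ra_counit Y) ∘ ra_unit (ra_functor Y) = idm (ra_functor Y)
}.

Arguments ra_unit {_ _ _} _ _.
Arguments ra_counit {_ _ _} _ _.

Definition is_iso (C : category) (A B : C) (f : A ~> B) : Prop :=
  exists g : B ~> A, g ∘ f = idm A /\ f ∘ g = idm B.

Definition is_terminal (C : category) (T : C) : Prop :=
  forall X : C, exists! f : X ~> T, True.

Definition is_pullback (C : category) (W X Y Z : C)
    (w1 : W ~> X) (w2 : W ~> Y) (f : X ~> Z) (g : Y ~> Z) : Prop :=
  f ∘ w1 = g ∘ w2 /\
  forall (V : C) (v1 : V ~> X) (v2 : V ~> Y), f ∘ v1 = g ∘ v2 ->
    exists! v : V ~> W, w1 ∘ v = v1 /\ w2 ∘ v = v2.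

Definition morphism_class (C : category) := forall A B : C, A ~> B -> Prop.

Definition left_lifting (X : category) (A B C D : X) (i : A ~> B) (q : C ~> D) : Prop :=
  forall (f : A ~> C) (g : B ~> D), q ∘ f = g ∘ i ->
    exists h : B ~> C, h ∘ i = f /\ q ∘ h = g.

Definition acyclic_cofibration (X : category) (fib : morphism_class X)
    (A B : X) (i : A ~> B) : Prop :=
  forall (C D : X) (q : C ~> D), fib C D q -> left_lifting i q.

Definition weakly_cartesian (C D : category) (q : functor C D) (A B : C) (f : A ~> B) : Prop :=
  forall (X : C) (g : X ~> B) (s : q X ~> q A), fmap q f ∘ s = fmap q g ->
    exists h : X ~> A, f ∘ h = g /\ fmap q h = s.

Definition cartesian (C D : category) (q : functor C D) (A B : C) (f : A ~> B) : Prop :=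
  forall (X : C) (g : X ~> B) (s : q X ~> q A), fmap q f ∘ s = fmap q g ->
    exists! h : X ~> A, f ∘ h = g /\ fmap q h = s.

Definition slice_hom (C : category) (X Y Z : C) (h : X ~> Z) (k : Y ~> Z) : Type :=
  {u : X ~> Y | k ∘ u = h}.

Definition slice_comp (C : category) (V X Y Z : C)
    (l : V ~> Z) (h : X ~> Z) (k : Y ~> Z)
    (u : slice_hom h k) (v : slice_hom l h) : slice_hom l k.
Proof.
exists (proj1_sig u ∘ proj1_sig v).
destruct u as [u Hu], v as [v Hv]; simpl.
now rewrite comp_assoc, Hu.
Defined.

Definition slice_fmap (C D : category) (F : functor C D) (X Y Z : C)
    (h : X ~> Z) (k : Y ~> Z) (u : slice_hom h k) :
    slice_hom (fmap F h) (fmap F k).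
Proof.
exists (fmap F (proj1_sig u)).
destruct u as [u Hu]; simpl.
now rewrite <- fmap_comp, Hu.
Defined.

(** A natural bijection (C/Z)(h, pi) ≅ (C/Y)(g^* h, f) for all [h : X ~> Z].
    Instead of choosing one pullback [g^* h], the bijection is given for each
    pullback [(W, w1, w2)] of [h] along [g], naturally in [h] and the pullback:
    the morphism [y] in [dpb_nat] is [g^* x]. *)
Record dep_prod_bijection (C : category) (A Y Z P : C)
    (f : A ~> Y) (g : Y ~> Z) (pi : P ~> Z) := DepProdBijection {
  dpb_map : forall (X : C) (h : X ~> Z) (W : C) (w1 : W ~> X) (w2 : W ~> Y),
    is_pullback w1 w2 h g -> slice_hom h pi -> slice_hom w2 f;
  dpb_bij : forall (X : C) (h : X ~> Z) (W : C) (w1 : W ~> X) (w2 : W ~> Y)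
      (pb : is_pullback w1 w2 h g) (k : slice_hom w2 f),
    exists! u : slice_hom h pi, dpb_map pb u = k;
  dpb_nat : forall (X : C) (h : X ~> Z) (W : C) (w1 : W ~> X) (w2 : W ~> Y)
      (pb : is_pullback w1 w2 h g)
      (X' : C) (h' : X' ~> Z) (W' : C) (w1' : W' ~> X') (w2' : W' ~> Y)
      (pb' : is_pullback w1' w2' h' g)
      (x : slice_hom h' h) (y : slice_hom w2' w2),
    w1 ∘ proj1_sig y = proj1_sig x ∘ w1' ->
    forall u : slice_hom h pi,
      dpb_map pb' (slice_comp u x) = slice_comp (dpb_map pb u) y
}.

Arguments dpb_map {_ _ _ _ _ _ _ _} _ {_ _ _ _ _} _ _.

Record is_ttfc (C : category) (fib : morphism_class C) : Prop := IsTTFC {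
  ttfc_terminal : exists T : C, is_terminal T;
  ttfc_comp : forall (X Y Z : C) (g : Y ~> Z) (f : X ~> Y),
    fib Y Z g -> fib X Y f -> fib X Z (g ∘ f);
  ttfc_iso : forall (A B : C) (f : A ~> B), is_iso f -> fib A B f;
  ttfc_to_terminal : forall (A T : C) (f : A ~> T), is_terminal T -> fib A T f;
  ttfc_pullback_ex : forall (X Y Z : C) (f : X ~> Z) (g : Y ~> Z), fib X Z f ->
    exists (W : C) (w1 : W ~> X) (w2 : W ~> Y), is_pullback w1 w2 f g;
  ttfc_pullback_fib : forall (W X Y Z : C) (w1 : W ~> X) (w2 : W ~> Y)
      (f : X ~> Z) (g : Y ~> Z),
    is_pullback w1 w2 f g -> fib X Z f -> fib W Y w2;
  ttfc_factor : forall (A B : C) (f : A ~> B),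
    exists (M : C) (i : A ~> M) (q : M ~> B),
      acyclic_cofibration fib i /\ fib M B q /\ f = q ∘ i;
  ttfc_dep_prod : forall (X Y Z : C) (f : X ~> Y) (g : Y ~> Z),
    fib X Y f -> fib Y Z g ->
    exists (P : C) (pi : P ~> Z), fib P Z pi /\ inhabited (dep_prod_bijection f g pi)
}.

(** Preservation of a dependent product [(pi, phi)] means that [F pi], with the
    bijection induced by [phi], is a dependent product of [F f] along [F g]:
    the bijection [phi'] for [F pi] agrees with [F phi] on the image of [F]. *)
Record type_theoretic_functor (C D : category)
    (fibC : morphism_class C) (fibD : morphism_class D) (F : functor C D) : Prop :=
  TypeTheoreticFunctor {
  ttf_terminal : forall T : C, is_terminal T -> is_terminal (F T);
  ttf_fib : forall (A B : C) (f : A ~> B), fibC A B f -> fibD (F A) (F B) (fmap F f);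
  ttf_pullback : forall (W X Y Z : C) (w1 : W ~> X) (w2 : W ~> Y)
      (f : X ~> Z) (g : Y ~> Z),
    fibC X Z f -> is_pullback w1 w2 f g ->
    is_pullback (fmap F w1) (fmap F w2) (fmap F f) (fmap F g);
  ttf_acof : forall (A B : C) (i : A ~> B),
    acyclic_cofibration fibC i -> acyclic_cofibration fibD (fmap F i);
  ttf_dep_prod : forall (X Y Z P : C) (f : X ~> Y) (g : Y ~> Z) (pi : P ~> Z)
      (phi : dep_prod_bijection f g pi),
    fibC X Y f -> fibC Y Z g -> fibC P Z pi ->
    exists phi' : dep_prod_bijection (fmap F f) (fmap F g) (fmap F pi),
      forall (V : C) (h : V ~> Z) (W : C) (w1 : W ~> V) (w2 : W ~> Y)
        (pb : is_pullback w1 w2 h g)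
        (pb' : is_pullback (fmap F w1) (fmap F w2) (fmap F h) (fmap F g))
        (u : slice_hom h pi),
        dpb_map phi' pb' (slice_fmap F u) = slice_fmap F (dpb_map phi pb u)
}.

Definition idto (C : category) (A B : C) (e : A = B) : A ~> B :=
  match e in _ = B' return A ~> B' with eq_refl => idm A end.

Section Fiber.
Variables (E B : category) (p : functor E B).

Record fiber_ob (I : B) := FiberOb {
  fo_ob :> E;
  fo_eq : p fo_ob = I
}.

Definition self (A : E) : fiber_ob (p A) := FiberOb eq_refl.

(** [f] is above [s], i.e. [p f = s] up to the equations [p X = I] and
    [p Y = J]. For [X = self _] and [Y = self _], this is [p f = s] up to
    composition with identities. *)
Definition above (I J : B) (s : I ~> J) (X : fiber_ob I) (Y : fiber_ob J)
    (f : fo_ob X ~> fo_ob Y) : Prop :=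
  idto (fo_eq Y) ∘ fmap p f = s ∘ idto (fo_eq X).

Lemma above_id (I : B) (X : fiber_ob I) : above (X := X) (Y := X) (idm I) (idm (fo_ob X)).
Proof. unfold above; now rewrite fmap_id, comp_idl, comp_idr. Qed.

Lemma above_comp (I J K : B) (t : J ~> K) (s : I ~> J)
    (X : fiber_ob I) (Y : fiber_ob J) (Z : fiber_ob K)
    (g : fo_ob Y ~> fo_ob Z) (f : fo_ob X ~> fo_ob Y) :
  above t g -> above s f -> above (X := X) (Y := Z) (t ∘ s) (g ∘ f).
Proof.
unfold above; intros Hg Hf.
now rewrite fmap_comp, comp_assoc, Hg, <- comp_assoc, Hf, comp_assoc.
Qed.

Lemma above_self (A C : E) (f : A ~> C) : above (X := self A) (Y := self C) (fmap p f) f.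
Proof. unfold above; simpl; now rewrite comp_idl, comp_idr. Qed.

Definition fiber_hom (I : B) (X Y : fiber_ob I) : Type :=
  {f : fo_ob X ~> fo_ob Y | above (idm I) f}.

Lemma fiber_hom_eq (I : B) (X Y : fiber_ob I) (f g : fiber_hom X Y) :
  proj1_sig f = proj1_sig g -> f = g.
Proof.
destruct f as [f Hf], g as [g Hg]; simpl; intros <-.
now rewrite (proof_irrelevance _ Hf Hg).
Qed.

Definition fiber_id (I : B) (X : fiber_ob I) : fiber_hom X X :=
  exist _ (idm (fo_ob X)) (above_id X).

Definition fiber_comp (I : B) (X Y Z : fiber_ob I)
    (g : fiber_hom Y Z) (f : fiber_hom X Y) : fiber_hom X Z.
Proof.
exists (proj1_sig g ∘ proj1_sig f).
exact (eq_ind _ (fun s => above s _) (above_comp (proj2_sig g) (proj2_sig f))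
  _ (comp_idl (idm I))).
Defined.

Definition fiber (I : B) : category.
Proof.
refine (@Category (fiber_ob I) (@fiber_hom I) (@fiber_id I) (@fiber_comp I) _ _ _).
- intros; apply fiber_hom_eq, comp_assoc.
- intros; apply fiber_hom_eq, comp_idl.
- intros; apply fiber_hom_eq, comp_idr.
Defined.

(** A Grothendieck fibration, with the choice of cartesian liftings which is
    implicit in speaking of the reindexing functors [s^*]. *)
Record cleavage := Cleavage {
  cl_ob : forall (I J : B), I ~> J -> fiber_ob J -> fiber_ob I;
  cl_lift : forall (I J : B) (s : I ~> J) (Y : fiber_ob J), fo_ob (cl_ob s Y) ~> fo_ob Y;
  cl_above : forall (I J : B) (s : I ~> J) (Y : fiber_ob J), above s (cl_lift s Y);
  cl_cartesian : forall (I J : B) (s : I ~> J) (Y : fiber_ob J), cartesian p (cl_lift s Y)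
}.

End Fiber.

Lemma idto_sym_l (C : category) (A B : C) (e : A = B) : idto (eq_sym e) ∘ idto e = idm A.
Proof. destruct e; apply comp_idl. Qed.

Lemma idto_sym_r (C : category) (A B : C) (e : A = B) : idto e ∘ idto (eq_sym e) = idm B.
Proof. destruct e; apply comp_idl. Qed.

Section Reindexing.
Variables (E B : category) (p : functor E B) (cl : cleavage p).

Lemma cl_factor_ex (I J K : B) (s : I ~> J) (r : K ~> I)
    (X : fiber_ob p K) (Y : fiber_ob p J) (g : fo_ob X ~> fo_ob Y) :
  above (s ∘ r) g ->
  exists! u : fo_ob X ~> fo_ob (cl_ob cl s Y), cl_lift cl s Y ∘ u = g /\ above r u.
Proof.
intros Hg; pose proof (cl_above cl s Y) as Hl.
set (Z := cl_ob cl s Y) in *; set (l := cl_lift cl s Y) in *.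
set (r0 := idto (eq_sym (fo_eq Z)) ∘ r ∘ idto (fo_eq X)).
assert (Hr0 : forall u : fo_ob X ~> fo_ob Z, above r u <-> fmap p u = r0).
{ intros u; unfold above, r0; split; intros H.
  - now rewrite <- comp_assoc, <- H, comp_assoc, idto_sym_l, comp_idl.
  - now rewrite H, !comp_assoc, idto_sym_r, comp_idl. }
assert (H0 : fmap p l ∘ r0 = fmap p g).
{ assert (Hl' : fmap p l = idto (eq_sym (fo_eq Y)) ∘ (s ∘ idto (fo_eq Z))).
  { now rewrite <- Hl, comp_assoc, idto_sym_l, comp_idl. }
  assert (Hg' : fmap p g = idto (eq_sym (fo_eq Y)) ∘ (s ∘ r ∘ idto (fo_eq X))).
  { now rewrite <- Hg, comp_assoc, idto_sym_l, comp_idl. }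
  rewrite Hl', Hg'; unfold r0.
  rewrite <- !comp_assoc; do 2 f_equal.
  now rewrite comp_assoc, idto_sym_r, comp_idl. }
destruct (@cl_cartesian _ _ _ cl _ _ s Y _ _ _ H0) as [u [[H1 H2] Hu]].
exists u; split; [split; [exact H1 | now apply Hr0]|].
intros v [Hv1 Hv2]; apply Hu; split; [exact Hv1 | now apply Hr0].
Qed.

(** The morphism [X ~> s^* Y] above [r] induced by [g : X ~> Y] above [s ∘ r]. *)
Definition cl_factor (I J K : B) (s : I ~> J) (r : K ~> I)
    (X : fiber_ob p K) (Y : fiber_ob p J) (g : fo_ob X ~> fo_ob Y)
    (Hg : above (s ∘ r) g) : fo_ob X ~> fo_ob (cl_ob cl s Y) :=
  proj1_sig (constructive_indefinite_description _ (cl_factor_ex Hg)).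

Lemma cl_factorP (I J K : B) (s : I ~> J) (r : K ~> I)
    (X : fiber_ob p K) (Y : fiber_ob p J) (g : fo_ob X ~> fo_ob Y)
    (Hg : above (s ∘ r) g) :
  cl_lift cl s Y ∘ cl_factor Hg = g /\ above r (cl_factor Hg).
Proof.
unfold cl_factor; destruct constructive_indefinite_description as [u [Hu ?]].
exact Hu.
Qed.

Lemma cl_factor_uniq (I J K : B) (s : I ~> J) (r : K ~> I)
    (X : fiber_ob p K) (Y : fiber_ob p J) (u v : fo_ob X ~> fo_ob (cl_ob cl s Y)) :
  above r u -> above r v -> cl_lift cl s Y ∘ u = cl_lift cl s Y ∘ v -> u = v.
Proof.
intros Hu Hv Huv.
destruct (cl_factor_ex (above_comp (cl_above cl s Y) Hu)) as [w [_ Hw]].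
transitivity w; [symmetry|]; apply Hw; split; auto.
Qed.

Lemma cl_factor_fiber_above (I J : B) (s : I ~> J) (X : fiber_ob p I) (Y : fiber_ob p J)
    (g : fo_ob X ~> fo_ob Y) : above s g -> above (s ∘ idm I) g.
Proof. now rewrite comp_idr. Qed.

(** The morphism [X ~> s^* Y] of the fiber induced by [g : X ~> Y] above [s]. *)
Definition cl_factor_fiber (I J : B) (s : I ~> J) (X : fiber p I) (Y : fiber p J)
    (g : fo_ob X ~> fo_ob Y) (Hg : above s g) :
    @hom (fiber p I) X (cl_ob cl s Y) :=
  exist _ (cl_factor (cl_factor_fiber_above Hg)) (proj2 (cl_factorP _)).

Lemma reindex_map_above (I J : B) (s : I ~> J) (X Y : fiber p J) (f : X ~> Y) :
  above s (proj1_sig f ∘ cl_lift cl s X).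
Proof.
exact (eq_ind _ (fun s' => above s' _) (above_comp (proj2_sig f) (cl_above cl s X))
  _ (comp_idl s)).
Qed.

Definition reindex_map (I J : B) (s : I ~> J) (X Y : fiber p J) (f : X ~> Y) :
    @hom (fiber p I) (cl_ob cl s X) (cl_ob cl s Y) :=
  cl_factor_fiber (reindex_map_above s f).

Lemma reindex_mapE (I J : B) (s : I ~> J) (X Y : fiber p J) (f : X ~> Y) :
  cl_lift cl s Y ∘ proj1_sig (reindex_map s f) = proj1_sig f ∘ cl_lift cl s X.
Proof. apply cl_factorP. Qed.

Definition reindex (I J : B) (s : I ~> J) : functor (fiber p J) (fiber p I).
Proof.
refine (@Functor (fiber p J) (fiber p I) (cl_ob cl s) (@reindex_map I J s) _ _).
- intros X; apply fiber_hom_eq, (cl_factor_uniq (proj2_sig _) (proj2_sig _)).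
  rewrite reindex_mapE; simpl; now rewrite comp_idl, comp_idr.
- intros X Y Z g f; apply fiber_hom_eq, (cl_factor_uniq (proj2_sig _) (proj2_sig _)).
  rewrite reindex_mapE; change (proj1_sig g ∘ proj1_sig f ∘ cl_lift cl s X =
    cl_lift cl s Z ∘ (proj1_sig (reindex_map s g) ∘ proj1_sig (reindex_map s f))).
  now rewrite (comp_assoc (cl_lift cl s Z)), reindex_mapE, <- !comp_assoc, reindex_mapE.
Defined.

Section BeckChevalley.
Variables (I J I' J' : B) (s : I ~> J) (r : J' ~> J) (s' : I' ~> J') (t : I' ~> I).
Hypothesis sq : s ∘ t = r ∘ s'.

Lemma reindex_square_above (X : fiber p J) :
  above (s ∘ t) (cl_lift cl r X ∘ cl_lift cl s' (cl_ob cl r X)).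
Proof. rewrite sq; exact (above_comp (cl_above _ _ _) (cl_above _ _ _)). Qed.

(** The canonical isomorphism [s'^* r^* X ~> t^* s^* X], compatible with the
    cartesian liftings to [X]. *)
Definition reindex_square (X : fiber p J) :
    reindex s' (reindex r X) ~> reindex t (reindex s X) :=
  cl_factor_fiber (X := cl_ob cl s' (cl_ob cl r X)) (Y := cl_ob cl s X)
    (proj2 (cl_factorP (reindex_square_above X))).

(** The component at [A] of [r^* s_* => s'_* t^*], the mate of
    [s'^* r^* ≅ t^* s^*]:
    [r^* s_* A ~> s'_* s'^* r^* s_* A ~> s'_* t^* s^* s_* A ~> s'_* t^* A]. *)
Definition beck_chevalley_map (R : right_adjoint (reindex s))
    (R' : right_adjoint (reindex s')) (A : fiber p I) :
    reindex r (R A) ~> R' (reindex t A) :=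
  fmap R' (fmap (reindex t) (ra_counit R A))
  ∘ fmap R' (reindex_square (R A))
  ∘ ra_unit R' (reindex r (R A)).

End BeckChevalley.

Definition reedy_fibration (fibB : morphism_class B)
    (fibF : forall I : B, morphism_class (fiber p I)) : morphism_class E :=
  fun A C f =>
    fibB (p A) (p C) (fmap p f) /\
    fibF (p A) (self p A) (cl_ob cl (fmap p f) (self p C))
      (cl_factor_fiber (X := self p A) (Y := self p C) (above_self p f)).

Lemma above_self_eq (A C : E) (J : B) (s : p A ~> J) (t : J ~> p C) (g : A ~> C) :
  fmap p g = t ∘ s -> above (X := self p A) (Y := self p C) (t ∘ s) g.
Proof. intros <-; apply above_self. Qed.

Record fibred_ttfc (fibE : morphism_class E) (fibB : morphism_class B) : Prop := FibredTTFC {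
  fttfc_total : is_ttfc fibE;
  fttfc_base : is_ttfc fibB;
  fttfc_functor : type_theoretic_functor fibE fibB p;
  fttfc_cart_fib : forall (A C : E) (f : A ~> C),
    cartesian p f -> fibB (p A) (p C) (fmap p f) -> fibE A C f;
  fttfc_induced_fib : forall (A C : E) (g : A ~> C) (J : B) (s : p A ~> J) (t : J ~> p C)
      (e : fmap p g = t ∘ s),
    fibE A C g -> fibB (p A) J s ->
    fibE A (fo_ob (cl_ob cl t (self p C)))
      (cl_factor (X := self p A) (Y := self p C) (above_self_eq e));
  fttfc_cart_acof : forall (A C : E) (f : A ~> C),
    cartesian p f -> acyclic_cofibration fibB (fmap p f) -> acyclic_cofibration fibE f
}.

End Reindexing.

(* Main.v *)
From Stdlib Require Import ProofIrrelevance IndefiniteDescription.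
Require Import Defs.

Set Implicit Arguments.
Unset Strict Implicit.
Unset Printing Implicit Defensive.

(** Call a morphism of [E] vertical if it lies above an identity. Since
    reindexing preserves pullbacks and dependent products of fibrations, the ones
    computed in a fiber are pullbacks and dependent products in [E]. A Reedy
    fibration is a vertical fibration followed by a cartesian morphism above a
    fibration, so pullbacks of Reedy fibrations are obtained by pasting. Dependent
    products along vertical fibrations come from the fibers, those of vertical
    fibrations along cartesian morphisms come from the right adjoints [s_*] and the
    Beck-Chevalley condition, and the general case is assembled from these two.
    For factorizations, an acyclic cofibration [i] of the base has a retraction
    [r], so that [A ~> r^* A] is cartesian above [i], hence an acyclic cofibration
    by the weak cartesianness hypothesis; that hypothesis also extends along it a
    morphism above [i] with fibrant codomain. *)

(** * Pullbacks *)

(** Three choices shape the argument. A dependent product is given as a bijection natural over all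
    pullbacks, and its preservation compares two such bijections. By Yoneda everything is carried by
    one counit, and pasting, reindexing and [p] act on counits directly. [reedy_fibration] refers to
    the chosen liftings of [cl], which are not closed under composition or pasting. It is therefore
    replaced by [rfib], a factorization through any cartesian morphism. Finally, [p] has to preserve
    pullbacks and dependent products, so each existence proof starts from a prescribed solution in
    the base and builds the solution in [E] above it. Arbitrary solutions are then compared with
    these by uniqueness up to isomorphism. The retraction used for factorizations exists because
    every object of the base is fibrant. *)

Section Pullbacks.
Variable C : category.

(** Serves rewriting: in a left-associated composite [x ∘ a ∘ b] the product [a ∘ b] is not a
    subterm. *)
Lemma comp_eq_l (V X Y Z : C) (a : Y ~> Z) (b : X ~> Y) (k : X ~> Z) (x : Z ~> V) :
  a ∘ b = k -> x ∘ a ∘ b = x ∘ k.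
Proof. intros <-; symmetry; apply comp_assoc. Qed.

Lemma is_iso_id (X : C) : is_iso (idm X).
Proof. exists (idm X); split; apply comp_idl. Qed.

Lemma is_pullback_lift (W X Y Z V : C) (w1 : W ~> X) (w2 : W ~> Y) (f : X ~> Z)
    (g : Y ~> Z) (v1 : V ~> X) (v2 : V ~> Y) :
  is_pullback w1 w2 f g -> f ∘ v1 = g ∘ v2 ->
  exists v : V ~> W, w1 ∘ v = v1 /\ w2 ∘ v = v2.
Proof. intros [_ H] e; destruct (H _ _ _ e) as [v [Hv _]]; now exists v. Qed.

Lemma is_pullback_inj (W X Y Z V : C) (w1 : W ~> X) (w2 : W ~> Y) (f : X ~> Z)
    (g : Y ~> Z) (u v : V ~> W) :
  is_pullback w1 w2 f g -> w1 ∘ u = w1 ∘ v -> w2 ∘ u = w2 ∘ v -> u = v.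
Proof.
intros [H0 H] e1 e2.
destruct (H V (w1 ∘ v) (w2 ∘ v)) as [x [_ Hx]].
- now rewrite !comp_assoc, H0.
- transitivity x; [symmetry|]; apply Hx; auto.
Qed.

Lemma is_pullback_intro (W X Y Z : C) (w1 : W ~> X) (w2 : W ~> Y) (f : X ~> Z)
    (g : Y ~> Z) :
  f ∘ w1 = g ∘ w2 ->
  (forall (V : C) (v1 : V ~> X) (v2 : V ~> Y), f ∘ v1 = g ∘ v2 ->
    exists v : V ~> W, w1 ∘ v = v1 /\ w2 ∘ v = v2) ->
  (forall (V : C) (u v : V ~> W), w1 ∘ u = w1 ∘ v -> w2 ∘ u = w2 ∘ v -> u = v) ->
  is_pullback w1 w2 f g.
Proof.
intros H0 H1 H2; split; [exact H0|]; intros V v1 v2 e.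
destruct (H1 _ _ _ e) as [v [e1 e2]]; exists v; split; [now split|].
intros v' [e1' e2']; apply H2; congruence.
Qed.

Lemma is_pullback_sym (W X Y Z : C) (w1 : W ~> X) (w2 : W ~> Y) (f : X ~> Z)
    (g : Y ~> Z) : is_pullback w1 w2 f g -> is_pullback w2 w1 g f.
Proof.
intros H; apply is_pullback_intro.
- symmetry; apply H.
- intros V v1 v2 e; destruct (is_pullback_lift H (eq_sym e)) as [v [? ?]]; now exists v.
- intros V u v e1 e2; now apply (is_pullback_inj H).
Qed.

Lemma is_pullback_paste (V W X Y Y' Z : C) (w1 : W ~> X) (w2 : W ~> Y) (f : X ~> Z)
    (g : Y ~> Z) (h : Y' ~> Y) (v1 : V ~> W) (v2 : V ~> Y') :
  is_pullback w1 w2 f g -> is_pullback v1 v2 w2 h -> is_pullback (w1 ∘ v1) v2 f (g ∘ h).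
Proof.
intros H H'; apply is_pullback_intro.
- now rewrite comp_assoc, (proj1 H), <- comp_assoc, (proj1 H'), comp_assoc.
- intros U u1 u2 e; rewrite <- comp_assoc in e.
  destruct (is_pullback_lift H e) as [w [e1 e2]].
  destruct (is_pullback_lift H' e2) as [v [e3 e4]].
  exists v; split; [now rewrite <- comp_assoc, e3 | exact e4].
- intros U u v e1 e2; apply (is_pullback_inj H'); [|exact e2].
  apply (is_pullback_inj H); rewrite !comp_assoc; [exact e1|].
  now rewrite (proj1 H'), <- !comp_assoc, e2.
Qed.

Lemma is_pullback_cancel (V W X Y Y' Z : C) (w1 : W ~> X) (w2 : W ~> Y) (f : X ~> Z)
    (g : Y ~> Z) (h : Y' ~> Y) (v1 : V ~> W) (v2 : V ~> Y') :
  is_pullback w1 w2 f g -> w2 ∘ v1 = h ∘ v2 ->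
  is_pullback (w1 ∘ v1) v2 f (g ∘ h) -> is_pullback v1 v2 w2 h.
Proof.
intros H e0 H'; apply is_pullback_intro; [exact e0| |].
- intros U u1 u2 e; destruct (@is_pullback_lift _ _ _ _ _ _ _ _ _ (w1 ∘ u1) u2 H')
    as [v [e1 e2]].
  { now rewrite comp_assoc, (proj1 H), <- comp_assoc, e, comp_assoc. }
  exists v; split; [|exact e2]; apply (is_pullback_inj H); [now rewrite comp_assoc|].
  now rewrite comp_assoc, e0, <- comp_assoc, e2.
- intros U u v e1 e2; apply (is_pullback_inj H'); [|exact e2].
  now rewrite <- !comp_assoc, e1.
Qed.

Lemma is_pullback_unique (W W' X Y Z : C) (w1 : W ~> X) (w2 : W ~> Y) (w1' : W' ~> X)
    (w2' : W' ~> Y) (f : X ~> Z) (g : Y ~> Z) :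
  is_pullback w1 w2 f g -> is_pullback w1' w2' f g ->
  exists b : W ~> W', is_iso b /\ w1' ∘ b = w1 /\ w2' ∘ b = w2.
Proof.
intros H H'.
destruct (is_pullback_lift H' (proj1 H)) as [b [e1 e2]].
destruct (is_pullback_lift H (proj1 H')) as [b' [e1' e2']].
exists b; split; [exists b'; split | now split].
- apply (is_pullback_inj H); rewrite comp_idr, comp_assoc; congruence.
- apply (is_pullback_inj H'); rewrite comp_idr, comp_assoc; congruence.
Qed.

Lemma is_pullback_iso (W W' X Y Z : C) (w1 : W ~> X) (w2 : W ~> Y) (w1' : W' ~> X)
    (w2' : W' ~> Y) (f : X ~> Z) (g : Y ~> Z) (b : W ~> W') :
  is_pullback w1' w2' f g -> is_iso b -> w1' ∘ b = w1 -> w2' ∘ b = w2 ->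
  is_pullback w1 w2 f g.
Proof.
intros H [b' [e e']] <- <-; apply is_pullback_intro.
- now rewrite !comp_assoc, (proj1 H).
- intros V v1 v2 ev; destruct (is_pullback_lift H ev) as [v [e1 e2]].
  exists (b' ∘ v); split; rewrite comp_assoc, (comp_eq_l _ e'), comp_idr; assumption.
- intros V u v e1 e2; rewrite <- !comp_assoc in e1; rewrite <- !comp_assoc in e2.
  pose proof (is_pullback_inj H e1 e2) as e3.
  now rewrite <- (comp_idl u), <- (comp_idl v), <- e, <- !comp_assoc, e3.
Qed.

Lemma is_pullback_id (X Y : C) (f : X ~> Y) : is_pullback f (idm X) (idm Y) f.
Proof.
apply is_pullback_intro.
- now rewrite comp_idl, comp_idr.
- intros V v1 v2 e; exists v2; rewrite comp_idl in e; rewrite comp_idl; split; congruence.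
- intros V u v _; now rewrite !comp_idl.
Qed.

Lemma is_terminal_inj (T X : C) (u v : X ~> T) : is_terminal T -> u = v.
Proof.
intros H; destruct (H X) as [w [_ Hw]].
transitivity w; [symmetry|]; now apply Hw.
Qed.

Lemma is_terminal_iso (T T' : C) : is_terminal T -> is_terminal T' ->
  exists b : T ~> T', is_iso b.
Proof.
intros H H'; destruct (H' T) as [b _], (H T') as [b' _].
exists b, b'; split; now apply is_terminal_inj.
Qed.

Lemma iso_is_terminal (T T' : C) (b : T ~> T') : is_iso b -> is_terminal T -> is_terminal T'.
Proof.
intros [b' [_ e]] H X; destruct (H X) as [u [_ Hu]].
exists (b ∘ u); split; [easy|]; intros v _.
now rewrite (Hu (b' ∘ v) I), comp_assoc, e, comp_idl.
Qed.

Lemma acyclic_cofibration_comp (fib : morphism_class C) (X Y Z : C)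
    (i : X ~> Y) (j : Y ~> Z) :
  acyclic_cofibration fib i -> acyclic_cofibration fib j -> acyclic_cofibration fib (j ∘ i).
Proof.
intros Hi Hj A D q Hq f g e; rewrite comp_assoc in e.
destruct (Hi _ _ _ Hq _ _ e) as [h [e1 e2]].
destruct (Hj _ _ _ Hq _ _ e2) as [k [e3 e4]].
exists k; split; [|exact e4]; now rewrite comp_assoc, e3.
Qed.

End Pullbacks.

Lemma fmap_iso (C D : category) (F : functor C D) (X Y : C) (b : X ~> Y) :
  is_iso b -> is_iso (fmap F b).
Proof.
intros [b' [e e']]; exists (fmap F b'); rewrite <- !fmap_comp, e, e', !fmap_id; auto.
Qed.

(** * Dependent products *)

Section DependentProducts.
Variable C : category.

(** Dependent products presented by their counit [e : g^* pi ~> f], where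
    [w2 : W ~> Y] is the pullback of [pi] along [g]. *)
Definition is_dep_prod (X Y Z P W : C) (f : X ~> Y) (g : Y ~> Z) (pi : P ~> Z)
    (w1 : W ~> P) (w2 : W ~> Y) (e : W ~> X) : Prop :=
  is_pullback w1 w2 pi g /\ f ∘ e = w2 /\
  forall (V Q : C) (h : V ~> Z) (q1 : Q ~> V) (q2 : Q ~> Y) (k : Q ~> X),
    is_pullback q1 q2 h g -> f ∘ k = q2 ->
    exists! u : V ~> P, pi ∘ u = h /\
      exists m : Q ~> W, w1 ∘ m = u ∘ q1 /\ w2 ∘ m = q2 /\ e ∘ m = k.

(** One pullback of each [h] along [g] suffices: any other is isomorphic to it, and [k] and [m] are
    transported along the comparison [b]. *)
Lemma is_dep_prod_intro (X Y Z P W : C) (f : X ~> Y) (g : Y ~> Z) (pi : P ~> Z)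
    (w1 : W ~> P) (w2 : W ~> Y) (e : W ~> X) :
  is_pullback w1 w2 pi g -> f ∘ e = w2 ->
  (forall (V : C) (h : V ~> Z), exists (Q : C) (q1 : Q ~> V) (q2 : Q ~> Y),
    is_pullback q1 q2 h g /\ forall k : Q ~> X, f ∘ k = q2 ->
    exists! u : V ~> P, pi ∘ u = h /\
      exists m : Q ~> W, w1 ∘ m = u ∘ q1 /\ w2 ∘ m = q2 /\ e ∘ m = k) ->
  is_dep_prod f g pi w1 w2 e.
Proof.
intros Hpb He H; split; [exact Hpb|split; [exact He|]].
intros V Q' h q1' q2' k' Hq' Hk'; destruct (H V h) as [Q [q1 [q2 [Hq HQ]]]].
destruct (is_pullback_unique Hq Hq') as [b [[b' [eb eb']] [e1 e2]]].
destruct (HQ (k' ∘ b)) as [u [[Hu [m [Hm1 [Hm2 Hm3]]]] Huniq]].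
{ now rewrite comp_assoc, Hk'. }
exists u; split.
- split; [exact Hu|]; exists (m ∘ b'); rewrite !comp_assoc, Hm1, Hm2, Hm3, <- e1, <- e2.
  rewrite !comp_assoc, !(comp_eq_l _ eb'), !comp_idr; auto.
- intros u' [Hu' [m' [Hm1' [Hm2' Hm3']]]]; apply Huniq; split; [exact Hu'|].
  exists (m' ∘ b); now rewrite !comp_assoc, Hm1', Hm2', Hm3', <- comp_assoc, e1.
Qed.

Lemma slice_hom_eq (X Y Z : C) (h : X ~> Z) (k : Y ~> Z) (u v : slice_hom h k) :
  proj1_sig u = proj1_sig v -> u = v.
Proof.
destruct u as [u Hu], v as [v Hv]; simpl; intros <-; now rewrite (proof_irrelevance _ Hu Hv).
Qed.

Definition slice_id (X Z : C) (h : X ~> Z) : slice_hom h h := exist _ (idm X) (comp_idr h).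

(** The Yoneda argument: naturality at [u], viewed as a morphism from [h] to [pi] in the slice,
    expresses the bijection through its value at the identity of [pi], the counit. *)
Lemma dpb_map_counit (X Y Z P W : C) (f : X ~> Y) (g : Y ~> Z) (pi : P ~> Z)
    (phi : dep_prod_bijection f g pi) (w1 : W ~> P) (w2 : W ~> Y)
    (pb : is_pullback w1 w2 pi g) (V Q : C) (h : V ~> Z) (q1 : Q ~> V) (q2 : Q ~> Y)
    (pb' : is_pullback q1 q2 h g) (u : slice_hom h pi) (m : Q ~> W) :
  w1 ∘ m = proj1_sig u ∘ q1 -> w2 ∘ m = q2 ->
  proj1_sig (dpb_map phi pb' u) = proj1_sig (dpb_map phi pb (slice_id pi)) ∘ m.
Proof.
intros H1 H2.
pose proof (@dpb_nat _ _ _ _ _ _ _ _ phi _ _ _ _ _ pb _ _ _ _ _ pb' u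
  (exist _ m H2) H1 (slice_id pi)) as H.
replace (slice_comp (slice_id pi) u) with u in H; [now rewrite H|].
apply slice_hom_eq; simpl; now rewrite comp_idl.
Qed.

Lemma dep_prod_of_bijection (X Y Z P W : C) (f : X ~> Y) (g : Y ~> Z) (pi : P ~> Z)
    (phi : dep_prod_bijection f g pi) (w1 : W ~> P) (w2 : W ~> Y)
    (pb : is_pullback w1 w2 pi g) :
  is_dep_prod f g pi w1 w2 (proj1_sig (dpb_map phi pb (slice_id pi))).
Proof.
split; [exact pb|split; [exact (proj2_sig (dpb_map phi pb _))|]].
intros V Q h q1 q2 k pb' Hk.
destruct (dpb_bij phi pb' (exist _ k Hk)) as [u [Hu Huniq]].
exists (proj1_sig u); split.
- split; [exact (proj2_sig u)|].
  destruct (@is_pullback_lift _ _ _ _ _ _ _ _ _ _ (proj1_sig u ∘ q1) q2 pb) as [m [e1 e2]].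
  { rewrite comp_assoc, (proj2_sig u); apply pb'. }
  exists m; split; [exact e1|split; [exact e2|]].
  now rewrite <- (dpb_map_counit phi pb pb' e1 e2), Hu.
- intros u' [Hu' [m [e1 [e2 e3]]]].
  rewrite (Huniq (exist _ u' Hu')); [reflexivity|].
  apply slice_hom_eq; simpl.
  now rewrite (@dpb_map_counit _ _ _ _ _ _ _ _ phi _ _ pb _ _ _ _ _ pb' _ m).
Qed.

(** The induced map [m] between pullbacks exists only propositionally, so it is chosen by
    description. By uniqueness of maps into a pullback, [dep_prod_mapE] may compute with any other
    [m]. *)
Definition dep_prod_map (X Y Z P W : C) (f : X ~> Y) (g : Y ~> Z) (pi : P ~> Z)
    (w1 : W ~> P) (w2 : W ~> Y) (e : W ~> X) (H : is_dep_prod f g pi w1 w2 e)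
    (V : C) (h : V ~> Z) (Q : C) (q1 : Q ~> V) (q2 : Q ~> Y)
    (pb : is_pullback q1 q2 h g) (u : slice_hom h pi) : slice_hom q2 f.
Proof.
refine (let m := constructive_indefinite_description _
  (@is_pullback_lift _ _ _ _ _ _ w1 w2 pi g (proj1_sig u ∘ q1) q2 (proj1 H) _) in _).
exists (e ∘ proj1_sig m).
rewrite comp_assoc, (proj1 (proj2 H)); exact (proj2 (proj2_sig m)).
Unshelve.
rewrite comp_assoc, (proj2_sig u); apply pb.
Defined.

Lemma dep_prod_mapE (X Y Z P W : C) (f : X ~> Y) (g : Y ~> Z) (pi : P ~> Z)
    (w1 : W ~> P) (w2 : W ~> Y) (e : W ~> X) (H : is_dep_prod f g pi w1 w2 e)
    (V : C) (h : V ~> Z) (Q : C) (q1 : Q ~> V) (q2 : Q ~> Y)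
    (pb : is_pullback q1 q2 h g) (u : slice_hom h pi) (m : Q ~> W) :
  w1 ∘ m = proj1_sig u ∘ q1 -> w2 ∘ m = q2 ->
  proj1_sig (dep_prod_map H pb u) = e ∘ m.
Proof.
intros e1 e2; unfold dep_prod_map; simpl.
destruct constructive_indefinite_description as [m' [e1' e2']]; simpl.
f_equal; apply (is_pullback_inj (proj1 H)); congruence.
Qed.

Lemma dep_prod_lift (X Y Z P W : C) (f : X ~> Y) (g : Y ~> Z) (pi : P ~> Z)
    (w1 : W ~> P) (w2 : W ~> Y) (e : W ~> X) (H : is_dep_prod f g pi w1 w2 e)
    (V : C) (h : V ~> Z) (Q : C) (q1 : Q ~> V) (q2 : Q ~> Y)
    (pb : is_pullback q1 q2 h g) (u : slice_hom h pi) :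
  exists m : Q ~> W, w1 ∘ m = proj1_sig u ∘ q1 /\ w2 ∘ m = q2.
Proof.
apply (is_pullback_lift (proj1 H)); rewrite comp_assoc, (proj2_sig u); apply pb.
Qed.

Definition bijection_of_dep_prod (X Y Z P W : C) (f : X ~> Y) (g : Y ~> Z) (pi : P ~> Z)
    (w1 : W ~> P) (w2 : W ~> Y) (e : W ~> X) (H : is_dep_prod f g pi w1 w2 e) :
  dep_prod_bijection f g pi.
Proof.
refine (@DepProdBijection _ _ _ _ _ _ _ _ (@dep_prod_map _ _ _ _ _ _ _ _ _ _ _ H) _ _).
- intros V h Q q1 q2 pb k.
  destruct (proj2 (proj2 H) _ _ _ _ _ _ pb (proj2_sig k)) as [u [[Hu [m [e1 [e2 e3]]]] Huniq]].
  exists (exist _ u Hu); split.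
  + apply slice_hom_eq; now rewrite (dep_prod_mapE _ _ (u := exist _ u Hu) e1 e2).
  + intros u' Hu'; apply slice_hom_eq; simpl; apply Huniq; split; [exact (proj2_sig u')|].
    destruct (dep_prod_lift H pb u') as [m' [e1' e2']].
    exists m'; split; [exact e1'|split; [exact e2'|]].
    rewrite <- Hu'; symmetry; now apply dep_prod_mapE.
- intros V h Q q1 q2 pb V' h' Q' q1' q2' pb' x y Hxy u; apply slice_hom_eq.
  destruct (dep_prod_lift H pb u) as [m [e1 e2]].
  rewrite (@dep_prod_mapE _ _ _ _ _ _ _ _ _ _ _ H _ _ _ _ _ pb' _ (m ∘ proj1_sig y)).
  + change (e ∘ (m ∘ proj1_sig y) = proj1_sig (dep_prod_map H pb u) ∘ proj1_sig y).
    rewrite (dep_prod_mapE H pb e1 e2); apply comp_assoc.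
  + simpl; now rewrite comp_assoc, e1, <- !comp_assoc, Hxy.
  + rewrite comp_assoc, e2; apply (proj2_sig y).
Defined.

(** Invariance under an isomorphism [a] over [Z]: [b] is the map of pullbacks induced by [a], so
    composing with [a] and its inverse carries one universal property to the other. *)
Lemma dep_prod_transport (X Y Z P P0 W W0 : C) (f : X ~> Y) (g : Y ~> Z)
    (pi : P ~> Z) (w1 : W ~> P) (w2 : W ~> Y) (e : W ~> X)
    (pi0 : P0 ~> Z) (w10 : W0 ~> P0) (w20 : W0 ~> Y) (e0 : W0 ~> X)
    (a : P ~> P0) (b : W ~> W0) :
  is_dep_prod f g pi0 w10 w20 e0 -> is_iso a -> pi0 ∘ a = pi -> is_pullback w1 w2 pi g ->
  w10 ∘ b = a ∘ w1 -> w20 ∘ b = w2 -> e0 ∘ b = e -> is_dep_prod f g pi w1 w2 e.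
Proof.
intros [H1 [H2 H3]] [a' [ea ea']] Hpi Hpb Hb1 Hb2 He; split; [exact Hpb|split].
{ now rewrite <- He, comp_assoc, H2. }
intros V Q h q1 q2 k pb Hk.
destruct (H3 _ _ _ _ _ _ pb Hk) as [u [[Hu [m [e1 [e2 e3]]]] Huniq]].
assert (Hau : pi ∘ (a' ∘ u) = h).
{ now rewrite <- Hpi, comp_assoc, (comp_eq_l _ ea'), comp_idr. }
exists (a' ∘ u); split.
- split; [exact Hau|].
  destruct (@is_pullback_lift _ _ _ _ _ _ w1 w2 pi g (a' ∘ u ∘ q1) q2 Hpb) as [n [n1 n2]].
  { rewrite comp_assoc, Hau; apply pb. }
  exists n; split; [exact n1|split; [exact n2|]].
  rewrite <- He, <- comp_assoc, <- e3; f_equal; apply (is_pullback_inj H1).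
  + now rewrite comp_assoc, Hb1, <- comp_assoc, n1, !comp_assoc, ea', comp_idl.
  + now rewrite comp_assoc, Hb2, n2.
- intros u' [Hu' [m' [e1' [e2' e3']]]]; rewrite (Huniq (a ∘ u')).
  + now rewrite comp_assoc, ea, comp_idl.
  + split; [now rewrite comp_assoc, Hpi|]; exists (b ∘ m'); rewrite !comp_assoc.
    rewrite Hb1, Hb2, He, <- (comp_assoc a w1), e1', comp_assoc; auto.
Qed.

Lemma dep_prod_unique (X Y Z P P0 W W0 : C) (f : X ~> Y) (g : Y ~> Z)
    (pi : P ~> Z) (w1 : W ~> P) (w2 : W ~> Y) (e : W ~> X)
    (pi0 : P0 ~> Z) (w10 : W0 ~> P0) (w20 : W0 ~> Y) (e0 : W0 ~> X) :
  is_dep_prod f g pi w1 w2 e -> is_dep_prod f g pi0 w10 w20 e0 ->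
  exists (a : P ~> P0) (b : W ~> W0), is_iso a /\ pi0 ∘ a = pi /\
    w10 ∘ b = a ∘ w1 /\ w20 ∘ b = w2 /\ e0 ∘ b = e.
Proof.
intros [H1 [H2 H3]] [K1 [K2 K3]].
destruct (K3 _ _ _ _ _ _ H1 H2) as [a [[Ha [b [b1 [b2 b3]]]] _]].
destruct (H3 _ _ _ _ _ _ K1 K2) as [a' [[Ha' [b' [b1' [b2' b3']]]] _]].
exists a, b; repeat split; auto; exists a'; split.
- destruct (H3 _ _ _ _ _ _ H1 H2) as [x [_ Hx]].
  transitivity x; [symmetry|]; apply Hx; split.
  + now rewrite comp_assoc, Ha'.
  + exists (b' ∘ b); rewrite !comp_assoc, b1', b2', b3'; repeat split; auto.
    now rewrite <- !comp_assoc, b1.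
  + apply comp_idr.
  + exists (idm W); rewrite !comp_idr, comp_idl; auto.
- destruct (K3 _ _ _ _ _ _ K1 K2) as [x [_ Hx]].
  transitivity x; [symmetry|]; apply Hx; split.
  + now rewrite comp_assoc, Ha.
  + exists (b ∘ b'); rewrite !comp_assoc, b1, b2, b3; repeat split; auto.
    now rewrite <- !comp_assoc, b1'.
  + apply comp_idr.
  + exists (idm W0); rewrite !comp_idr, comp_idl; auto.
Qed.

(** Right adjoints compose: [Π_c (Π_g f)] is a dependent product along [c ∘ g], because pullback
    along [c ∘ g] is pullback along [c] followed by pullback along [g]. The new counit is that of
    [c], reindexed along [g], followed by that of [g]. *)
Lemma dep_prod_comp (X Y U Z Q N W1 W2 : C) (f : X ~> Y) (g : Y ~> U) (c : U ~> Z)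
    (q : Q ~> U) (v1 : W1 ~> Q) (v2 : W1 ~> Y) (d : W1 ~> X)
    (pi : N ~> Z) (w1 : W2 ~> N) (w2 : W2 ~> U) (e : W2 ~> Q) :
  (forall (V : C) (h : V ~> U), exists (W : C) (p1 : W ~> V) (p2 : W ~> Y),
     is_pullback p1 p2 h g) ->
  (forall (V : C) (h : V ~> Z), exists (W : C) (p1 : W ~> V) (p2 : W ~> U),
     is_pullback p1 p2 h c) ->
  is_dep_prod f g q v1 v2 d -> is_dep_prod q c pi w1 w2 e ->
  exists (W3 : C) (p1 : W3 ~> N) (p2 : W3 ~> Y) (k : W3 ~> X),
    is_dep_prod f (c ∘ g) pi p1 p2 k.
Proof.
intros Hg Hc [A1 [A2 A3]] [B1 [B2 B3]].
destruct (Hg _ w2) as [W3 [x1 [x2 pbx]]].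
destruct (@is_pullback_lift _ _ _ _ _ _ v1 v2 q g (e ∘ x1) x2 A1) as [n [n1 n2]].
{ rewrite comp_assoc, B2; apply pbx. }
exists W3, (w1 ∘ x1), x2, (d ∘ n); apply is_dep_prod_intro.
- exact (is_pullback_paste B1 pbx).
- now rewrite comp_assoc, A2, n2.
- intros V h; destruct (Hc _ h) as [S [s1 [s2 pbs]]].
  destruct (Hg _ s2) as [T [t1 [t2 pbt]]].
  exists T, (s1 ∘ t1), t2; split; [exact (is_pullback_paste pbs pbt)|].
  intros k Hk.
  destruct (A3 _ _ _ _ _ _ pbt Hk) as [l [[Hl [m [m1 [m2 m3]]]] Hluniq]].
  destruct (B3 _ _ _ _ _ _ pbs Hl) as [u [[Hu [o [o1 [o2 o3]]]] Huuniq]].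
  exists u; split.
  + split; [exact Hu|].
    destruct (@is_pullback_lift _ _ _ _ _ _ x1 x2 w2 g (o ∘ t1) t2 pbx) as [r [r1 r2]].
    { rewrite comp_assoc, o2; apply pbt. }
    exists r; split; [|split; [exact r2|]].
    * now rewrite <- comp_assoc, r1, comp_assoc, o1, comp_assoc.
    * rewrite <- m3, <- comp_assoc; f_equal; apply (is_pullback_inj A1).
      -- now rewrite comp_assoc, n1, <- comp_assoc, r1, comp_assoc, o3, m1.
      -- now rewrite comp_assoc, n2, r2, m2.
  + intros u' [Hu' [r' [r1' [r2' r3']]]]; apply Huuniq; split; [exact Hu'|].
    destruct (@is_pullback_lift _ _ _ _ _ _ w1 w2 pi c (u' ∘ s1) s2 B1) as [o' [o1' o2']].
    { rewrite comp_assoc, Hu'; apply pbs. }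
    exists o'; split; [exact o1'|split; [exact o2'|]].
    symmetry; apply Hluniq; split; [now rewrite comp_assoc, B2|].
    exists (n ∘ r'); rewrite comp_assoc, n1, !comp_assoc, n2, r3'; repeat split; auto.
    rewrite <- !comp_assoc; f_equal; apply (is_pullback_inj B1).
    * now rewrite !comp_assoc, r1', o1', comp_assoc.
    * rewrite !comp_assoc, o2', (proj1 pbx), (proj1 pbt), <- comp_assoc; congruence.
Qed.

End DependentProducts.

(** * Functors preserving dependent products, in terms of counits *)

Section Functors.
Variables (C D : category) (fibC : morphism_class C) (fibD : morphism_class D).
Variable F : functor C D.

(** Evaluating the compatibility of the two bijections at the identity of [pi] shows that [F] sends
    the counit to the counit. *)
Lemma ttf_is_dep_prod (X Y Z P W : C) (f : X ~> Y) (g : Y ~> Z) (pi : P ~> Z)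
    (w1 : W ~> P) (w2 : W ~> Y) (e : W ~> X) :
  type_theoretic_functor fibC fibD F ->
  fibC f -> fibC g -> fibC pi -> is_dep_prod f g pi w1 w2 e ->
  is_dep_prod (fmap F f) (fmap F g) (fmap F pi) (fmap F w1) (fmap F w2) (fmap F e).
Proof.
intros HF Hf Hg Hpi H.
destruct (ttf_dep_prod HF (bijection_of_dep_prod H) Hf Hg Hpi) as [phi' Hphi'].
pose proof (ttf_pullback HF Hpi (proj1 H)) as pb'.
pose proof (Hphi' _ _ _ _ _ (proj1 H) pb' (slice_id pi)) as He.
assert (Hid : slice_fmap F (slice_id pi) = slice_id (fmap F pi)).
{ apply slice_hom_eq; simpl; apply fmap_id. }
rewrite Hid in He.
assert (He' : proj1_sig (dpb_map phi' pb' (slice_id (fmap F pi))) = fmap F e).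
{ rewrite He.
  change (fmap F (proj1_sig (dep_prod_map H (proj1 H) (slice_id pi))) = fmap F e).
  rewrite (@dep_prod_mapE _ _ _ _ _ _ _ _ _ _ _ _ H _ _ _ _ _ (proj1 H) (slice_id pi)
    (idm W)); simpl; now rewrite ?comp_idl, ?comp_idr. }
rewrite <- He'; apply dep_prod_of_bijection.
Qed.

(** Converse direction: once the image of one counit is universal, compatibility at every [h]
    follows, since both sides are composites with that counit. *)
Lemma preserves_dep_prod_bijection (X Y Z P W : C) (f : X ~> Y) (g : Y ~> Z) (pi : P ~> Z)
    (phi : dep_prod_bijection f g pi)
    (w1 : W ~> P) (w2 : W ~> Y) (pb : is_pullback w1 w2 pi g) :
  is_dep_prod (fmap F f) (fmap F g) (fmap F pi) (fmap F w1) (fmap F w2)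
    (fmap F (proj1_sig (dpb_map phi pb (slice_id pi)))) ->
  exists phi' : dep_prod_bijection (fmap F f) (fmap F g) (fmap F pi),
    forall (V : C) (h : V ~> Z) (Q : C) (q1 : Q ~> V) (q2 : Q ~> Y)
      (pb : is_pullback q1 q2 h g)
      (pb' : is_pullback (fmap F q1) (fmap F q2) (fmap F h) (fmap F g))
      (u : slice_hom h pi),
      dpb_map phi' pb' (slice_fmap F u) = slice_fmap F (dpb_map phi pb u).
Proof.
intros H; exists (bijection_of_dep_prod H); intros V h Q q1 q2 pbq pbq' u.
apply slice_hom_eq.
change (proj1_sig (dep_prod_map H pbq' (slice_fmap F u)) = fmap F (proj1_sig (dpb_map phi pbq u))).
destruct (@is_pullback_lift _ _ _ _ _ _ w1 w2 pi g (proj1_sig u ∘ q1) q2 pb) as [m [e1 e2]].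
{ rewrite comp_assoc, (proj2_sig u); apply pbq. }
rewrite (dpb_map_counit phi pb pbq e1 e2), fmap_comp.
apply dep_prod_mapE; simpl; rewrite <- !fmap_comp; congruence.
Qed.

End Functors.

(** * Morphisms above a base morphism *)

Section Displayed.
Variables (E B : category) (p : functor E B).

(** [bs X Y f] is [p f] corrected by the equations [p X = I] and [p Y = J], so
    that [above s f] becomes the equation [bs X Y f = s]. *)
Definition bs (I J : B) (X : fiber_ob p I) (Y : fiber_ob p J) (f : fo_ob X ~> fo_ob Y) :
    I ~> J :=
  idto (fo_eq Y) ∘ fmap p f ∘ idto (eq_sym (fo_eq X)).

Arguments bs {I J} X Y f.

Lemma bs_self (A C : E) (f : A ~> C) : bs (self p A) (self p C) f = fmap p f.
Proof. unfold bs; simpl; now rewrite comp_idl, comp_idr. Qed.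

Lemma above_bs (I J : B) (s : I ~> J) (X : fiber_ob p I) (Y : fiber_ob p J)
    (f : fo_ob X ~> fo_ob Y) : above s f <-> bs X Y f = s.
Proof.
(* Eliminating the equations [p X = I] leaves objects of the form [self X], for which every [idto]
   is an identity. *)
destruct X as [X e]; destruct e; destruct Y as [Y e]; destruct e.
unfold above, bs; simpl; now rewrite !comp_idl, !comp_idr.
Qed.

Lemma bs_comp (I J K : B) (X : fiber_ob p I) (Y : fiber_ob p J) (Z : fiber_ob p K)
    (g : fo_ob Y ~> fo_ob Z) (f : fo_ob X ~> fo_ob Y) :
  bs X Z (g ∘ f) = bs Y Z g ∘ bs X Y f.
Proof.
destruct X as [X e]; destruct e; destruct Y as [Y e]; destruct e.
destruct Z as [Z e]; destruct e.
unfold bs; simpl; now rewrite !comp_idl, !comp_idr, fmap_comp.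
Qed.

Arguments bs_comp {I J K} X Y Z g f.

Lemma bs_id (I : B) (X : fiber_ob p I) : bs X X (idm (fo_ob X)) = idm I.
Proof. now apply above_bs, above_id. Qed.

Lemma bs_iso (I J : B) (X : fiber_ob p I) (Y : fiber_ob p J) (f : fo_ob X ~> fo_ob Y) :
  is_iso f -> is_iso (bs X Y f).
Proof.
intros [g [e e']]; exists (bs Y X g); now rewrite <- !bs_comp, e, e', !bs_id.
Qed.

Lemma bs_fiber (I : B) (X Y : fiber p I) (f : X ~> Y) : bs X Y (proj1_sig f) = idm I.
Proof. apply above_bs, (proj2_sig f). Qed.

Lemma bs_fiber_l (I J : B) (X Y : fiber p I) (V : fiber_ob p J) (f : X ~> Y)
    (v : fo_ob V ~> fo_ob X) : bs V Y (proj1_sig f ∘ v) = bs V X v.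
Proof. now rewrite (bs_comp V X Y), bs_fiber, comp_idl. Qed.

Definition vert (I : B) (X Y : fiber p I) (f : fo_ob X ~> fo_ob Y) (H : bs X Y f = idm I) :
  X ~> Y := exist _ f (proj2 (above_bs (idm I) f) H).

Lemma cart_lift (I' I K : B) (X' : fiber_ob p I') (X : fiber_ob p I)
    (c : fo_ob X' ~> fo_ob X) (V : fiber_ob p K) (g : fo_ob V ~> fo_ob X) (r : K ~> I') :
  cartesian p c -> bs V X g = bs X' X c ∘ r ->
  exists u : fo_ob V ~> fo_ob X', c ∘ u = g /\ bs V X' u = r.
Proof.
destruct X' as [X' e]; destruct e; destruct X as [X e]; destruct e.
destruct V as [V e]; destruct e; unfold bs; simpl; rewrite !comp_idl, !comp_idr.
intros H e; destruct (H V g r (eq_sym e)) as [u [[e1 e2] _]].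
exists u; now rewrite comp_idl, comp_idr.
Qed.

Lemma cart_inj (I' I K : B) (X' : fiber_ob p I') (X : fiber_ob p I)
    (c : fo_ob X' ~> fo_ob X) (V : fiber_ob p K) (u v : fo_ob V ~> fo_ob X') :
  cartesian p c -> c ∘ u = c ∘ v -> bs V X' u = bs V X' v -> u = v.
Proof.
destruct X' as [X' e]; destruct e; destruct X as [X e]; destruct e.
destruct V as [V e]; destruct e; unfold bs; simpl; rewrite !comp_idl, !comp_idr.
intros H e1 e2; destruct (H V (c ∘ u) (fmap p u)) as [x [_ Hx]].
- symmetry; apply fmap_comp.
- transitivity x; [symmetry|]; apply Hx; auto.
Qed.

Lemma cartesian_intro (I' I : B) (X' : fiber_ob p I') (X : fiber_ob p I)
    (c : fo_ob X' ~> fo_ob X) :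
  (forall (K : B) (V : fiber_ob p K) (g : fo_ob V ~> fo_ob X) (r : K ~> I'),
    bs V X g = bs X' X c ∘ r -> exists u : fo_ob V ~> fo_ob X', c ∘ u = g /\ bs V X' u = r) ->
  (forall (K : B) (V : fiber_ob p K) (u v : fo_ob V ~> fo_ob X'),
    c ∘ u = c ∘ v -> bs V X' u = bs V X' v -> u = v) -> cartesian p c.
Proof.
destruct X' as [X' e]; destruct e; destruct X as [X e]; destruct e; simpl in c.
intros H1 H2 V g r e.
destruct (H1 _ (self p V) g r) as [u [e1 e2]].
- rewrite (bs_self (A := V)), (bs_self (A := X')); auto.
- exists u; split; [split; [exact e1|now rewrite <- (bs_self (A := V))]|].
  intros v [e3 e4]; apply (H2 _ (self p V)); [exact (eq_trans e1 (eq_sym e3))|].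
  now rewrite e2, (bs_self (A := V)).
Qed.

Lemma cartesian_comp (I J K : B) (X : fiber_ob p I) (Y : fiber_ob p J) (Z : fiber_ob p K)
    (d : fo_ob Y ~> fo_ob Z) (c : fo_ob X ~> fo_ob Y) :
  cartesian p d -> cartesian p c -> cartesian p (d ∘ c).
Proof.
intros Hd Hc; apply (cartesian_intro (X' := X) (X := Z)).
- intros L V g r e; rewrite (bs_comp X Y Z), <- comp_assoc in e.
  destruct (cart_lift Hd e) as [u [e1 e2]].
  destruct (cart_lift Hc e2) as [v [e3 e4]].
  exists v; split; [now rewrite <- comp_assoc, e3|exact e4].
- intros L V u v e1 e2; apply (cart_inj Hc); [|exact e2].
  apply (cart_inj Hd); [now rewrite !comp_assoc|].
  now rewrite !(bs_comp V X Y), e2.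
Qed.

Lemma cartesian_cancel (I J K : B) (X : fiber_ob p I) (Y : fiber_ob p J) (Z : fiber_ob p K)
    (d : fo_ob Y ~> fo_ob Z) (c : fo_ob X ~> fo_ob Y) :
  cartesian p d -> cartesian p (d ∘ c) -> cartesian p c.
Proof.
intros Hd Hdc; apply (cartesian_intro (X' := X) (X := Y)).
- intros L V g r e.
  destruct (@cart_lift _ _ _ X Z (d ∘ c) V (d ∘ g) r Hdc) as [u [e1 e2]].
  { now rewrite (bs_comp V Y Z), (bs_comp X Y Z), e, comp_assoc. }
  exists u; split; [|exact e2]; apply (cart_inj Hd); [now rewrite comp_assoc|].
  now rewrite (bs_comp V X Y), e2.
- intros L V u v e1 e2; apply (@cart_inj _ _ _ X Z _ _ _ _ Hdc); [|exact e2].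
  now rewrite <- !comp_assoc, e1.
Qed.

Lemma cartesian_iso (I J : B) (X : fiber_ob p I) (Y : fiber_ob p J) (c : fo_ob X ~> fo_ob Y) :
  is_iso c -> cartesian p c.
Proof.
intros [d [e e']]; apply (cartesian_intro (X' := X) (X := Y)).
- intros K V g r er; exists (d ∘ g); split; [now rewrite comp_assoc, e', comp_idl|].
  now rewrite (bs_comp V Y X), er, comp_assoc, <- (bs_comp X Y X), e, bs_id, comp_idl.
- intros K V u v e1 _.
  now rewrite <- (comp_idl u), <- (comp_idl v), <- e, <- !comp_assoc, e1.
Qed.

Lemma cartesian_unique (I J : B) (X X' : fiber_ob p I) (Y : fiber_ob p J)
    (c : fo_ob X ~> fo_ob Y) (c' : fo_ob X' ~> fo_ob Y) :
  cartesian p c -> cartesian p c' -> bs X Y c = bs X' Y c' ->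
  exists b : fo_ob X ~> fo_ob X', is_iso b /\ c' ∘ b = c /\ bs X X' b = idm I.
Proof.
intros Hc Hc' e.
destruct (@cart_lift _ _ _ X' Y c' X c (idm I) Hc') as [b [e1 e2]]; [now rewrite comp_idr|].
destruct (@cart_lift _ _ _ X Y c X' c' (idm I) Hc) as [b' [e1' e2']]; [now rewrite comp_idr|].
exists b; split; [exists b'; split|now split].
- apply (cart_inj Hc).
  + now rewrite comp_assoc, e1', e1, comp_idr.
  + now rewrite (bs_comp X X' X), e2, e2', bs_id, comp_idl.
- apply (cart_inj Hc').
  + now rewrite comp_assoc, e1, e1', comp_idr.
  + now rewrite (bs_comp X' X X'), e2, e2', bs_id, comp_idl.
Qed.

Lemma bs_iso_vert (I : B) (X Y : fiber_ob p I) (f : fo_ob X ~> fo_ob Y)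
    (g : fo_ob Y ~> fo_ob X) :
  bs X Y f = idm I -> g ∘ f = idm (fo_ob X) -> bs Y X g = idm I.
Proof. intros H e; now rewrite <- (comp_idr (bs Y X g)), <- H, <- bs_comp, e, bs_id. Qed.

Lemma is_iso_vert (I : B) (X Y : fiber_ob p I) (f : fo_ob X ~> fo_ob Y)
    (H : bs X Y f = idm I) : is_iso f -> is_iso (vert H).
Proof.
intros [g [e e']]; exists (vert (bs_iso_vert H e)); split; now apply fiber_hom_eq.
Qed.

(** Every object of [E] is some [self V]; test objects are given with a base so that [bs] applies to
    their maps. *)
Lemma total_pullback_intro (W X Y Z : E) (w1 : W ~> X) (w2 : W ~> Y) (f : X ~> Z)
    (g : Y ~> Z) :
  f ∘ w1 = g ∘ w2 ->
  (forall (I : B) (V : fiber_ob p I) (v1 : fo_ob V ~> X) (v2 : fo_ob V ~> Y),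
    f ∘ v1 = g ∘ v2 -> exists v : fo_ob V ~> W, w1 ∘ v = v1 /\ w2 ∘ v = v2) ->
  (forall (I : B) (V : fiber_ob p I) (u v : fo_ob V ~> W),
    w1 ∘ u = w1 ∘ v -> w2 ∘ u = w2 ∘ v -> u = v) ->
  is_pullback w1 w2 f g.
Proof.
intros H0 H1 H2; apply is_pullback_intro; [exact H0| |]; intros V.
- exact (H1 _ (self p V)).
- exact (H2 _ (self p V)).
Qed.

(** The base pullback supplies the base component of the mediating map, cartesianness of [x] lifts
    it, and cartesianness of [y] checks the second projection. *)
Lemma cart_square_pullback (I' I J' J : B) (X' : fiber_ob p I') (X : fiber_ob p I)
    (Y' : fiber_ob p J') (Y : fiber_ob p J) (x : fo_ob X' ~> fo_ob X)
    (y : fo_ob Y' ~> fo_ob Y) (f' : fo_ob X' ~> fo_ob Y') (f : fo_ob X ~> fo_ob Y) :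
  cartesian p x -> cartesian p y -> f ∘ x = y ∘ f' ->
  is_pullback (bs X' X x) (bs X' Y' f') (bs X Y f) (bs Y' Y y) ->
  is_pullback x f' f y.
Proof.
intros Hx Hy e pb; apply total_pullback_intro; [exact e| |].
- intros K V v1 v2 ev.
  assert (ev' : bs X Y f ∘ bs V X v1 = bs Y' Y y ∘ bs V Y' v2).
  { now rewrite <- !bs_comp, ev. }
  destruct (is_pullback_lift pb ev') as [r [e1 e2]].
  destruct (cart_lift Hx (eq_sym e1)) as [u [e3 e4]].
  exists u; split; [exact e3|]; apply (cart_inj Hy).
  + now rewrite comp_assoc, <- e, <- comp_assoc, e3.
  + now rewrite <- e2, <- e4, (bs_comp V X' Y').
- intros K V u v e1 e2; apply (cart_inj Hx e1), (is_pullback_inj pb).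
  + now rewrite <- !bs_comp, e1.
  + now rewrite <- !bs_comp, e2.
Qed.

Lemma cart_square_pullback_vert (I J : B) (X' Y' : fiber_ob p I) (X Y : fiber_ob p J)
    (x : fo_ob X' ~> fo_ob X) (y : fo_ob Y' ~> fo_ob Y)
    (f' : fo_ob X' ~> fo_ob Y') (f : fo_ob X ~> fo_ob Y) :
  cartesian p x -> cartesian p y -> f ∘ x = y ∘ f' ->
  bs X' X x = bs Y' Y y -> bs X' Y' f' = idm I -> bs X Y f = idm J ->
  is_pullback x f' f y.
Proof.
intros Hx Hy e e1 e2 e3; apply (cart_square_pullback Hx Hy e).
rewrite e1, e2, e3; apply is_pullback_id.
Qed.

End Displayed.

Arguments bs {E B p I J} X Y f.
Arguments bs_comp {E B p I J K} X Y Z g f.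

(** * Maps into a reindexed object as maps above a base morphism *)

Section Reindexing.
Variables (E B : category) (p : functor E B) (cl : cleavage p).

Lemma bs_cl (I J : B) (s : I ~> J) (Y : fiber_ob p J) :
  bs (cl_ob cl s Y) Y (cl_lift cl s Y) = s.
Proof. apply above_bs, cl_above. Qed.

Lemma reindexE (I J : B) (s : I ~> J) (X Y : fiber p J) (f : X ~> Y) :
  cl_lift cl s Y ∘ proj1_sig (fmap (reindex cl s) f) = proj1_sig f ∘ cl_lift cl s X.
Proof. exact (reindex_mapE cl s f). Qed.

Lemma reindex_compE (I J : B) (s : I ~> J) (V : fiber p I) (X Y : fiber p J) (f : X ~> Y)
    (u : V ~> reindex cl s X) :
  cl_lift cl s Y ∘ proj1_sig (fmap (reindex cl s) f ∘ u) =
  proj1_sig f ∘ (cl_lift cl s X ∘ proj1_sig u).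
Proof.
rewrite comp_assoc, <- reindexE; apply (comp_assoc (cl_lift cl s Y)).
Qed.

Lemma reindex_totalE (I J K : B) (s : I ~> J) (V : fiber_ob p K) (X Y : fiber p J)
    (f : X ~> Y) (m : fo_ob V ~> fo_ob (cl_ob cl s X)) :
  cl_lift cl s Y ∘ (proj1_sig (fmap (reindex cl s) f) ∘ m) = proj1_sig f ∘ (cl_lift cl s X ∘ m).
Proof. rewrite !comp_assoc; f_equal; apply reindexE. Qed.

Lemma cl_cart (I J : B) (s : I ~> J) (Y : fiber_ob p J) : cartesian p (cl_lift cl s Y).
Proof. apply cl_cartesian. Qed.

Arguments cl_cart {I J} s Y.

Lemma cartesian_ex (I J : B) (s : I ~> J) (Y : fiber_ob p J) :
  exists (X : fiber_ob p I) (c : fo_ob X ~> fo_ob Y), cartesian p c /\ bs X Y c = s.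
Proof.
exists (cl_ob cl s Y), (cl_lift cl s Y); split; [apply (cl_cart s Y)|apply bs_cl].
Qed.

Lemma cl_lift_ex (I J K : B) (s : I ~> J) (r : K ~> I) (X : fiber_ob p K)
    (Y : fiber_ob p J) (g : fo_ob X ~> fo_ob Y) : bs X Y g = s ∘ r ->
  exists u : fo_ob X ~> fo_ob (cl_ob cl s Y), cl_lift cl s Y ∘ u = g /\ bs X _ u = r.
Proof. intros e; apply (cart_lift (cl_cart s Y)); now rewrite bs_cl. Qed.

Lemma cl_vert_ex (I J : B) (s : I ~> J) (X : fiber p I) (Y : fiber p J)
    (g : fo_ob X ~> fo_ob Y) : bs X Y g = s ->
  exists u : X ~> reindex cl s Y, cl_lift cl s Y ∘ proj1_sig u = g.
Proof.
intros e; destruct (@cl_lift_ex _ _ _ s (idm I) X Y g) as [u [e1 e2]].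
- now rewrite comp_idr.
- now exists (vert e2).
Qed.

Lemma cl_vert_inj (I J : B) (s : I ~> J) (X : fiber p I) (Y : fiber p J)
    (u v : X ~> reindex cl s Y) :
  cl_lift cl s Y ∘ proj1_sig u = cl_lift cl s Y ∘ proj1_sig v -> u = v.
Proof.
intros e; apply fiber_hom_eq, (cart_inj (cl_cart s Y) e).
transitivity (idm I); [|symmetry]; apply bs_fiber.
Qed.

Lemma bs_cl_vert (I J : B) (s : I ~> J) (X : fiber p I) (Y : fiber p J)
    (u : X ~> reindex cl s Y) : bs X Y (cl_lift cl s Y ∘ proj1_sig u) = s.
Proof.
transitivity (s ∘ idm I); [|apply comp_idr].
rewrite (bs_comp X (cl_ob cl s Y) Y), bs_cl; f_equal; exact (bs_fiber u).
Qed.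

Lemma reindex_squareE (I J I' J' : B) (s : I ~> J) (r : J' ~> J) (s' : I' ~> J')
    (t : I' ~> I) (sq : s ∘ t = r ∘ s') (X : fiber p J) :
  cl_lift cl s X ∘ cl_lift cl t (cl_ob cl s X) ∘ proj1_sig (reindex_square cl sq X) =
  cl_lift cl r X ∘ cl_lift cl s' (cl_ob cl r X).
Proof.
unfold reindex_square; simpl; rewrite <- comp_assoc.
now rewrite (proj1 (cl_factorP cl _)), (proj1 (cl_factorP cl _)).
Qed.

End Reindexing.

Arguments cl_cart {E B p} cl {I J} s Y.

(** * Transposition for a right adjoint *)

Section Adjunction.
Variables (C D : category) (F : functor C D) (R : right_adjoint F).

Lemma ra_transpose (X : C) (Y : D) (k : F X ~> Y) :
  ra_counit R Y ∘ fmap F (fmap R k ∘ ra_unit R X) = k.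
Proof.
now rewrite fmap_comp, comp_assoc, ra_counit_nat, <- comp_assoc, ra_triangle_l, comp_idr.
Qed.

Lemma ra_transpose_inj (X : C) (Y : D) (u v : X ~> R Y) :
  ra_counit R Y ∘ fmap F u = ra_counit R Y ∘ fmap F v -> u = v.
Proof.
intros e.
assert (H : forall w : X ~> R Y, w = fmap R (ra_counit R Y ∘ fmap F w) ∘ ra_unit R X).
{ intros w.
  now rewrite fmap_comp, <- comp_assoc, <- ra_unit_nat, comp_assoc, ra_triangle_r, comp_idl. }
now rewrite (H u), (H v), e.
Qed.

End Adjunction.

(** * Reedy fibrations *)

Section ReedyFibrations.
Variables (E B : category) (p : functor E B) (cl : cleavage p).
Variables (fibB : morphism_class B) (fibF : forall I : B, morphism_class (fiber p I)).
Hypothesis base_ttfc : is_ttfc fibB.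
Hypothesis fiber_ttfc : forall I : B, is_ttfc (@fibF I).
Hypothesis reindex_ttf : forall (I J : B) (s : I ~> J),
  type_theoretic_functor (@fibF J) (@fibF I) (reindex cl s).

(** A fibration of the fiber regarded as a morphism of [E]: verticality is an existential proof, so
    composites in [E] need no repackaging as morphisms of the fiber. *)
Definition vfib (I : B) (X Y : fiber p I) (f : fo_ob X ~> fo_ob Y) : Prop :=
  exists H : bs X Y f = idm I, @fibF I X Y (vert H).

Arguments vfib {I} X Y f.

Lemma vfib_bs (I : B) (X Y : fiber p I) (f : fo_ob X ~> fo_ob Y) :
  vfib X Y f -> bs X Y f = idm I.
Proof. now intros [H _]. Qed.

Lemma vfibE (I : B) (X Y : fiber p I) (f : X ~> Y) : vfib X Y (proj1_sig f) <-> @fibF I X Y f.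
Proof.
assert (e : forall H, vert H = f) by (intros H; now apply fiber_hom_eq).
split.
- intros [H Hf]; now rewrite e in Hf.
- intros Hf; exists (bs_fiber f); now rewrite e.
Qed.

Lemma vfib_comp (I : B) (X Y Z : fiber p I) (g : fo_ob Y ~> fo_ob Z) (f : fo_ob X ~> fo_ob Y) :
  vfib Y Z g -> vfib X Y f -> vfib X Z (g ∘ f).
Proof.
intros [Hg Fg] [Hf Ff].
exact (proj2 (vfibE (vert Hg ∘ vert Hf)) (ttfc_comp (fiber_ttfc I) Fg Ff)).
Qed.

Lemma vfib_iso (I : B) (X Y : fiber p I) (f : fo_ob X ~> fo_ob Y) :
  bs X Y f = idm I -> is_iso f -> vfib X Y f.
Proof. intros H Hf; exists H; now apply (ttfc_iso (fiber_ttfc I)), is_iso_vert. Qed.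

(** For arbitrary cartesian [x] and [y], [f'] is the chosen reindexing of [f] up to the isomorphisms
    comparing [x] and [y] with the chosen liftings. *)
Lemma vfib_reindex (I J : B) (X Y : fiber p J) (X' Y' : fiber p I)
    (x : fo_ob X' ~> fo_ob X) (y : fo_ob Y' ~> fo_ob Y)
    (f : fo_ob X ~> fo_ob Y) (f' : fo_ob X' ~> fo_ob Y') :
  cartesian p x -> cartesian p y -> bs X' X x = bs Y' Y y ->
  vfib X Y f -> f ∘ x = y ∘ f' -> bs X' Y' f' = idm I -> vfib X' Y' f'.
Proof.
intros Hx Hy exy [Hf Ff] e Hf'.
set (s := bs X' X x) in *.
destruct (cartesian_unique (X := X') (X' := cl_ob cl s X) Hx (cl_cart cl s X))
  as [a [Ha [ea va]]]; [now rewrite bs_cl|].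
destruct (cartesian_unique (X := cl_ob cl s Y) (X' := Y') (cl_cart cl s Y) Hy)
  as [b [Hb [eb vb]]]; [now rewrite bs_cl|].
assert (e' : f' = b ∘ (proj1_sig (fmap (reindex cl s) (vert Hf)) ∘ a)).
{ apply (cart_inj (X' := Y') (X := Y) (V := X') Hy).
  - rewrite <- e, !comp_assoc, eb, reindexE; symmetry; exact (comp_eq_l f ea).
  - rewrite Hf', (bs_comp X' (cl_ob cl s Y) Y'), (bs_comp X' (cl_ob cl s X) (cl_ob cl s Y)).
    rewrite va, vb, !comp_idl, comp_idr; symmetry; apply (bs_fiber (fmap (reindex cl s) (vert Hf))). }
rewrite e'; apply (vfib_comp (Y := cl_ob cl s Y)); [now apply vfib_iso|].
apply (vfib_comp (Y := cl_ob cl s X)); [|now apply vfib_iso].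
apply (vfibE (fmap (reindex cl s) (vert Hf))), (ttf_fib (reindex_ttf s) Ff).
Qed.

(** A form of [reedy_fibration] independent of the cleavage and of the base equations: [c] may be
    any cartesian morphism. [reedyE] proves the equivalence. *)
Definition rfib (I J : B) (X : fiber p I) (Y : fiber p J) (f : fo_ob X ~> fo_ob Y) : Prop :=
  fibB (bs X Y f) /\ exists (Y' : fiber p I) (c : fo_ob Y' ~> fo_ob Y) (v : fo_ob X ~> fo_ob Y'),
    cartesian p c /\ vfib X Y' v /\ c ∘ v = f.

Arguments rfib {I J} X Y f.

Lemma bs_vfib_l (I J : B) (X Y' : fiber p I) (Y : fiber p J) (c : fo_ob Y' ~> fo_ob Y)
    (v : fo_ob X ~> fo_ob Y') : vfib X Y' v -> bs X Y (c ∘ v) = bs Y' Y c.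
Proof. intros Hv; now rewrite (bs_comp X Y' Y), (vfib_bs Hv), comp_idr. Qed.

Lemma bs_vfib_r (I J : B) (X Y : fiber p I) (V : fiber p J) (f : fo_ob X ~> fo_ob Y)
    (v : fo_ob V ~> fo_ob X) : vfib X Y f -> bs V Y (f ∘ v) = bs V X v.
Proof. intros Hv; now rewrite (bs_comp V X Y), (vfib_bs Hv), comp_idl. Qed.

(** With [f = c ∘ v], the morphism [y] factors through [c] by some cartesian [y1], so [f'] is a
    reindexing of [v]. With [x] an identity this says that the vertical part of a Reedy fibration is
    a fibration for every choice of cartesian part. *)
Lemma vfib_of_rfib (I J K : B) (X : fiber p I) (Y : fiber p J) (X' Y' : fiber p K)
    (x : fo_ob X' ~> fo_ob X) (y : fo_ob Y' ~> fo_ob Y)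
    (f : fo_ob X ~> fo_ob Y) (f' : fo_ob X' ~> fo_ob Y') :
  cartesian p x -> cartesian p y -> rfib X Y f -> f ∘ x = y ∘ f' ->
  bs X' Y' f' = idm K -> vfib X' Y' f'.
Proof.
intros Hx Hy [_ [Y1 [c [v [Hc [Hv Hf]]]]]] e Hf'.
assert (ey : bs Y' Y y = bs Y1 Y c ∘ bs X' X x).
{ transitivity (bs X' Y (f ∘ x)).
  - now rewrite e, (bs_comp X' Y' Y), Hf', comp_idr.
  - now rewrite (bs_comp X' X Y), <- Hf, (bs_vfib_l (Y := Y) c Hv). }
destruct (cart_lift Hc ey) as [y1 [e1 e2]].
apply (vfib_reindex (X := X) (Y := Y1) (x := x) (y := y1) (f := v)); auto.
- apply (cartesian_cancel (X := Y') (Y := Y1) (Z := Y) Hc); now rewrite e1.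
- apply (cart_inj (X' := Y1) (X := Y) (V := X') Hc).
  + now rewrite !comp_assoc, Hf, e1.
  + now rewrite (bs_vfib_r (V := X') x Hv), (bs_comp X' Y' Y1), Hf', e2, comp_idr.
Qed.

Lemma rfib_intro (I J : B) (X Y' : fiber p I) (Y : fiber p J) (c : fo_ob Y' ~> fo_ob Y)
    (v : fo_ob X ~> fo_ob Y') (f : fo_ob X ~> fo_ob Y) :
  cartesian p c -> fibB (bs Y' Y c) -> vfib X Y' v -> c ∘ v = f -> rfib X Y f.
Proof.
intros Hc Fc Hv <-; split; [now rewrite (bs_vfib_l (Y := Y) c Hv)|].
now exists Y', c, v.
Qed.

Lemma rfib_cl (I J : B) (s : I ~> J) (X : fiber p I) (Y : fiber p J) (f : fo_ob X ~> fo_ob Y)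
    (u : X ~> reindex cl s Y) :
  bs X Y f = s -> cl_lift cl s Y ∘ proj1_sig u = f ->
  rfib X Y f <-> fibB s /\ @fibF I _ _ u.
Proof.
intros es eu; split.
- intros Hf; split; [rewrite <- es; apply Hf|].
  apply vfibE; apply (vfib_of_rfib (X' := X) (X := X) (Y := Y) (Y' := cl_ob cl s Y)
    (x := idm _) (y := cl_lift cl s Y) (f := f)); auto.
  + apply (cartesian_iso (X := X) (Y := X)), is_iso_id.
  + apply (cl_cart cl s Y).
  + now rewrite comp_idr.
  + apply (bs_fiber u).
- intros [Hs Hu]; apply (rfib_intro (Y' := cl_ob cl s Y) (c := cl_lift cl s Y)
    (v := proj1_sig u)); auto.
  + apply (cl_cart cl s Y).
  + now rewrite (bs_cl cl s Y).
  + now apply vfibE.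
Qed.

Lemma reedyE (I J : B) (X : fiber p I) (Y : fiber p J) (f : fo_ob X ~> fo_ob Y) :
  reedy_fibration cl fibB fibF f <-> rfib X Y f.
Proof.
destruct X as [X e]; destruct e; destruct Y as [Y e]; destruct e; simpl in f.
symmetry; apply rfib_cl; [apply bs_self|].
exact (proj1 (cl_factorP cl (cl_factor_fiber_above (above_self p f)))).
Qed.

Lemma rfib_comp (I J K : B) (X : fiber p I) (Y : fiber p J) (Z : fiber p K)
    (g : fo_ob Y ~> fo_ob Z) (f : fo_ob X ~> fo_ob Y) :
  rfib Y Z g -> rfib X Y f -> rfib X Z (g ∘ f).
Proof.
intros Hg [Ff [Y1 [c [v [Hc [Hv Hf]]]]]].
pose proof Hg as [Fg [Z1 [d [w [Hd [Hw Hgw]]]]]].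
set (s := bs Y1 Y c).
assert (es : bs X Y f = s) by (rewrite <- Hf; apply (bs_vfib_l (Y := Y) c Hv)).
(* In [d ∘ w ∘ c ∘ v] the middle factors are exchanged: [w ∘ c] is the reindexing [w'] of [w]
   followed by a cartesian morphism. *)
destruct (@cl_lift_ex _ _ _ cl _ _ _ s (idm I) Y1 Z1 (w ∘ c)) as [w' [e1 e2]].
{ now rewrite (bs_vfib_r (V := Y1) c Hw), comp_idr. }
apply (rfib_intro (Y' := cl_ob cl s Z1) (c := d ∘ cl_lift cl s Z1) (v := w' ∘ v)).
- apply (cartesian_comp (Y := Z1) Hd (cl_cart cl s Z1)).
- rewrite (bs_comp (cl_ob cl s Z1) Z1 Z), bs_cl.
  rewrite <- es; apply (ttfc_comp base_ttfc); [|exact Ff].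
  rewrite <- (bs_vfib_l (Y := Z) d Hw), Hgw; exact Fg.
- apply (vfib_comp (Y := Y1)); [|exact Hv].
  apply (vfib_reindex (X := Y) (Y := Z1) (x := c) (y := cl_lift cl s Z1) (f := w)); auto.
  + apply (cl_cart cl s Z1).
  + now rewrite bs_cl.
- now rewrite comp_assoc, <- (comp_assoc d), e1, comp_assoc, Hgw, <- comp_assoc, Hf.
Qed.

Lemma rfib_cartesian (I J : B) (X : fiber p I) (Y : fiber p J) (c : fo_ob X ~> fo_ob Y) :
  cartesian p c -> fibB (bs X Y c) -> rfib X Y c.
Proof.
intros Hc Fc; apply (rfib_intro (Y' := X) (c := c) (v := idm _)); auto.
- apply vfib_iso; [apply bs_id|apply is_iso_id].
- apply comp_idr.
Qed.

Lemma rfib_vfib (I : B) (X Y : fiber p I) (f : fo_ob X ~> fo_ob Y) : vfib X Y f -> rfib X Y f.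
Proof.
intros Hf; apply (rfib_intro (Y' := Y) (c := idm _) (v := f)); auto.
- apply (cartesian_iso (X := Y) (Y := Y)), is_iso_id.
- rewrite bs_id; apply (ttfc_iso base_ttfc), is_iso_id.
- apply comp_idl.
Qed.

Lemma rfib_iso (I J : B) (X : fiber p I) (Y : fiber p J) (f : fo_ob X ~> fo_ob Y) :
  is_iso f -> rfib X Y f.
Proof.
intros Hf; apply rfib_cartesian; [now apply (cartesian_iso (X := X) (Y := Y))|].
now apply (ttfc_iso base_ttfc), bs_iso.
Qed.

(** * Terminal objects *)

(** With the next lemma: a map into a fiberwise terminal object amounts to its base component,
    because reindexing preserves terminal objects. *)
Lemma fiber_terminal_lift (I J : B) (s : I ~> J) (T : fiber p J) (V : fiber p I) :
  is_terminal T -> exists v : fo_ob V ~> fo_ob T, bs V T v = s.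
Proof.
intros HT; destruct (ttf_terminal (reindex_ttf s) HT V) as [v _].
exists (cl_lift cl s T ∘ proj1_sig v); apply bs_cl_vert.
Qed.

Lemma fiber_terminal_inj (I J : B) (T : fiber p J) (V : fiber p I)
    (u v : fo_ob V ~> fo_ob T) : is_terminal T -> bs V T u = bs V T v -> u = v.
Proof.
intros HT e.
destruct (@cl_vert_ex _ _ _ cl _ _ _ V T u eq_refl) as [u' eu].
destruct (@cl_vert_ex _ _ _ cl _ _ (bs V T u) V T v (eq_sym e)) as [v' ev].
rewrite <- eu, <- ev; do 2 f_equal.
exact (is_terminal_inj _ _ (ttf_terminal (reindex_ttf (bs V T u)) HT)).
Qed.

Lemma total_terminal (J : B) (T : fiber p J) :
  is_terminal J -> is_terminal T -> is_terminal (fo_ob T).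
Proof.
intros HJ HT V; destruct (HJ (p V)) as [s _].
destruct (@fiber_terminal_lift _ _ s T (self p V) HT) as [v _].
exists v; split; [easy|]; intros v' _.
apply (@fiber_terminal_inj _ _ T (self p V) _ _ HT); now apply is_terminal_inj.
Qed.

Lemma total_terminal_ex : exists (J : B) (T : fiber p J),
  is_terminal J /\ is_terminal T /\ is_terminal (fo_ob T).
Proof.
destruct (ttfc_terminal base_ttfc) as [J HJ].
destruct (ttfc_terminal (fiber_ttfc J)) as [T HT].
exists J, T; repeat split; auto; now apply total_terminal.
Qed.

(** Any terminal object of [E] is isomorphic to the one constructed above a terminal object of the
    base. *)
Lemma fmap_terminal (T : E) : is_terminal T -> is_terminal (p T).
Proof.
intros HT; destruct total_terminal_ex as [J [T0 [HJ [HT0 HE]]]].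
destruct (is_terminal_iso HE HT) as [b Hb].
apply (iso_is_terminal (T := J) (b := bs T0 (self p T) b)); [|exact HJ].
exact (@bs_iso _ _ _ _ _ T0 (self p T) b Hb).
Qed.

Lemma rfib_to_terminal (A T : E) (f : A ~> T) : is_terminal T -> rfib (self p A) (self p T) f.
Proof.
intros HT; set (s := fmap p f).
destruct (@cl_vert_ex _ _ _ cl _ _ s (self p A) (self p T) f (bs_self p f)) as [u eu].
apply (rfib_cl (bs_self p f) eu); split.
- apply (ttfc_to_terminal base_ttfc), fmap_terminal, HT.
(* The reindexing of [T] is terminal in its fiber: maps into it are maps into [T] above [s], and
   those are unique in [E]. *)
- apply (ttfc_to_terminal (fiber_ttfc (p A))); intros X.
  destruct (HT (fo_ob X)) as [k Hk].
  assert (ek : bs X (self p T) k = s ∘ idm (p A)) by apply is_terminal_inj, fmap_terminal, HT.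
  destruct (cl_lift_ex cl ek) as [v [e1 e2]].
  exists (vert e2); split; [easy|]; intros v' _.
  apply cl_vert_inj; now apply is_terminal_inj.
Qed.

(** * Pullbacks of Reedy fibrations *)

(** Maps above [r] into objects of the fiber over [J] are vertical maps into their reindexings along
    [r], and reindexing along [r] preserves this pullback. *)
Lemma fiber_pullback_total (J : B) (W X Y Z : fiber p J) (w1 : W ~> X) (w2 : W ~> Y)
    (f : X ~> Z) (g : Y ~> Z) :
  @fibF J X Z f -> is_pullback w1 w2 f g ->
  is_pullback (proj1_sig w1) (proj1_sig w2) (proj1_sig f) (proj1_sig g).
Proof.
intros Ff pb; apply (total_pullback_intro (p := p)).
- exact (f_equal (@proj1_sig _ _) (proj1 pb)).
- intros I V v1 v2 e; set (r := bs V X v1).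
  assert (er : bs V Y v2 = r).
  { unfold r; now rewrite <- (bs_fiber_l f v1), e, bs_fiber_l. }
  destruct (cl_vert_ex cl (eq_refl r : bs V X v1 = r)) as [u1 e1].
  destruct (cl_vert_ex cl er) as [u2 e2].
  destruct (@is_pullback_lift _ _ _ _ _ _ _ _ _ _ u1 u2 (ttf_pullback (reindex_ttf r) Ff pb))
    as [v [e3 e4]].
  { apply cl_vert_inj; rewrite !reindex_compE, e1, e2; exact e. }
  exists (cl_lift cl r W ∘ proj1_sig v); rewrite <- !reindex_compE, e3, e4; now split.
- intros I V u v e1 e2; set (r := bs V W u).
  assert (er : bs V W v = r).
  { unfold r; now rewrite <- (bs_fiber_l w1 u), e1, bs_fiber_l. }
  destruct (cl_vert_ex cl (eq_refl r : bs V W u = r)) as [u' eu].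
  destruct (cl_vert_ex cl er) as [v' ev].
  rewrite <- eu, <- ev; do 2 f_equal.
  apply (is_pullback_inj (ttf_pullback (reindex_ttf r) Ff pb));
    apply cl_vert_inj; rewrite !reindex_compE, eu, ev; assumption.
Qed.

(** Pastes two squares: reindex [f] along the base of [g], then pull back in the fiber along the
    vertical part [g'] of [g]. *)
Lemma vfib_pullback_ex (J K : B) (X Z : fiber p J) (Y : fiber p K)
    (f : fo_ob X ~> fo_ob Z) (g : fo_ob Y ~> fo_ob Z) : vfib X Z f ->
  exists (W : fiber p K) (w1 : fo_ob W ~> fo_ob X) (w2 : fo_ob W ~> fo_ob Y),
    is_pullback w1 w2 f g /\ vfib W Y w2.
Proof.
intros [Hf Ff]; set (r := bs Y Z g).
destruct (cl_vert_ex cl (eq_refl r : bs Y Z g = r)) as [g' eg].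
set (f' := fmap (reindex cl r) (vert Hf)).
pose proof (ttf_fib (reindex_ttf r) Ff : @fibF K _ _ f') as Ff'.
destruct (ttfc_pullback_ex (fiber_ttfc K) g' Ff') as [W [a [b pb]]].
exists W, (cl_lift cl r X ∘ proj1_sig a), (proj1_sig b); split.
- rewrite <- eg; apply (is_pullback_paste (w2 := proj1_sig f')).
  + apply (cart_square_pullback_vert (X' := cl_ob cl r X) (Y' := cl_ob cl r Z) (X := X)
      (Y := Z)).
    * apply (cl_cart cl r X).
    * apply (cl_cart cl r Z).
    * symmetry; exact (reindexE cl r (vert Hf)).
    * now rewrite !bs_cl.
    * apply (bs_fiber f').
    * exact Hf.
  + now apply fiber_pullback_total.
- apply vfibE; exact (ttfc_pullback_fib (fiber_ttfc K) pb Ff').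
Qed.

Lemma rfib_pullback_above (I J I' J' : B) (X : fiber p I) (Z : fiber p J) (Y : fiber p J')
    (f : fo_ob X ~> fo_ob Z) (g : fo_ob Y ~> fo_ob Z) (t : I' ~> I) (s' : I' ~> J') :
  rfib X Z f -> is_pullback t s' (bs X Z f) (bs Y Z g) ->
  exists (W : fiber p I') (w1 : fo_ob W ~> fo_ob X) (w2 : fo_ob W ~> fo_ob Y),
    is_pullback w1 w2 f g /\ rfib W Y w2 /\ bs W X w1 = t /\ bs W Y w2 = s'.
Proof.
intros [Fs [Z1 [c [v [Hc [Hv Hf]]]]]] pb.
assert (ec : bs Z1 Z c = bs X Z f) by (rewrite <- Hf; symmetry; now apply bs_vfib_l).
set (Y1 := cl_ob cl s' Y); set (d := cl_lift cl s' Y).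
pose proof (cl_cart cl s' Y : cartesian p d) as Hd.
pose proof (bs_cl cl s' Y : bs Y1 Y d = s') as ed.
(* The cartesian morphisms [d] and [c] form a pullback square with [m] above the prescribed base
   pullback; it remains to pull the vertical part [v] back along [m]. *)
destruct (@cart_lift _ _ _ _ _ _ Z1 Z c Y1 (g ∘ d) t Hc) as [m [e1 e2]].
{ rewrite (bs_comp Y1 Y Z), ed, ec; symmetry; apply pb. }
destruct (vfib_pullback_ex (Y := Y1) m Hv) as [W [w1 [w2 [pbw Hw2]]]].
exists W, w1, (d ∘ w2); split; [|split; [|split]].
- rewrite <- Hf; apply is_pullback_sym, (is_pullback_paste (w2 := m)).
  + apply (cart_square_pullback (X' := Y1) (X := Y) (Y' := Z1) (Y := Z)); auto.
    rewrite ed, ec, e2; now apply is_pullback_sym.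
  + now apply is_pullback_sym.
- apply (rfib_intro (Y' := Y1) (c := d) (v := w2)); auto.
  rewrite ed; exact (ttfc_pullback_fib base_ttfc pb Fs).
- rewrite <- (bs_vfib_r (V := W) w1 Hv), (proj1 pbw), (bs_vfib_l (Y := Z1) m Hw2); exact e2.
- rewrite (bs_vfib_l (Y := Y) d Hw2); exact ed.
Qed.

Lemma rfib_pullback_ex (I J J' : B) (X : fiber p I) (Z : fiber p J) (Y : fiber p J')
    (f : fo_ob X ~> fo_ob Z) (g : fo_ob Y ~> fo_ob Z) : rfib X Z f ->
  exists (I' : B) (t : I' ~> I) (s' : I' ~> J') (W : fiber p I')
    (w1 : fo_ob W ~> fo_ob X) (w2 : fo_ob W ~> fo_ob Y),
    is_pullback t s' (bs X Z f) (bs Y Z g) /\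
    is_pullback w1 w2 f g /\ rfib W Y w2 /\ bs W X w1 = t /\ bs W Y w2 = s'.
Proof.
intros Hf; destruct (ttfc_pullback_ex base_ttfc (bs Y Z g) (proj1 Hf)) as [I' [t [s' pb]]].
destruct (rfib_pullback_above Hf pb) as [W [w1 [w2 H]]].
now exists I', t, s', W, w1, w2.
Qed.

(** An arbitrary pullback is isomorphic to the constructed one, which lies above a base pullback;
    both claims transfer along this isomorphism. *)
Lemma rfib_pullback (I J K L : B) (W : fiber p L) (X : fiber p I) (Y : fiber p K)
    (Z : fiber p J) (w1 : fo_ob W ~> fo_ob X) (w2 : fo_ob W ~> fo_ob Y)
    (f : fo_ob X ~> fo_ob Z) (g : fo_ob Y ~> fo_ob Z) :
  rfib X Z f -> is_pullback w1 w2 f g ->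
  rfib W Y w2 /\ is_pullback (bs W X w1) (bs W Y w2) (bs X Z f) (bs Y Z g).
Proof.
intros Hf pb.
destruct (rfib_pullback_ex g Hf) as [I' [t [s' [W0 [x1 [x2 [pbb [pb0 [Hx2 [e1 e2]]]]]]]]]].
destruct (is_pullback_unique pb pb0) as [b [Hb [eb1 eb2]]]; split.
- rewrite <- eb2; apply (rfib_comp (Y := W0) Hx2); now apply rfib_iso.
- apply (is_pullback_iso pbb (b := bs W W0 b)).
  + now apply bs_iso.
  + now rewrite <- e1, <- bs_comp, eb1.
  + now rewrite <- e2, <- bs_comp, eb2.
Qed.

(** * Dependent products of Reedy fibrations *)

Lemma total_dep_prod_intro (X Y Z P W : E) (f : X ~> Y) (g : Y ~> Z) (pi : P ~> Z)
    (w1 : W ~> P) (w2 : W ~> Y) (e : W ~> X) :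
  is_pullback w1 w2 pi g -> f ∘ e = w2 ->
  (forall (I : B) (V : fiber p I) (h : fo_ob V ~> Z),
    exists (Q : E) (q1 : Q ~> fo_ob V) (q2 : Q ~> Y),
    is_pullback q1 q2 h g /\ forall k : Q ~> X, f ∘ k = q2 ->
    exists! u : fo_ob V ~> P, pi ∘ u = h /\
      exists m : Q ~> W, w1 ∘ m = u ∘ q1 /\ w2 ∘ m = q2 /\ e ∘ m = k) ->
  is_dep_prod f g pi w1 w2 e.
Proof.
intros pb He H; apply is_dep_prod_intro; [exact pb|exact He|].
intros V; exact (H _ (self p V)).
Qed.

Lemma fiber_dep_prod_total (J : B) (X Y Z P W : fiber p J) (f : X ~> Y) (g : Y ~> Z)
    (pi : P ~> Z) (w1 : W ~> P) (w2 : W ~> Y) (e : W ~> X) :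
  @fibF J _ _ f -> @fibF J _ _ g -> @fibF J _ _ pi -> is_dep_prod f g pi w1 w2 e ->
  is_dep_prod (proj1_sig f) (proj1_sig g) (proj1_sig pi) (proj1_sig w1) (proj1_sig w2)
    (proj1_sig e).
Proof.
intros Ff Fg Fpi H; apply total_dep_prod_intro.
- exact (fiber_pullback_total Fpi (proj1 H)).
- exact (f_equal (@proj1_sig _ _) (proj1 (proj2 H))).
- intros K V h; set (r := bs V Z h).
  destruct (cl_vert_ex cl (eq_refl r : bs V Z h = r)) as [h' eh].
  set (g' := fmap (reindex cl r) g).
  pose proof (ttf_fib (reindex_ttf r) Fg : @fibF K _ _ g') as Fg'.
  destruct (ttfc_pullback_ex (fiber_ttfc K) h' Fg') as [Q [q2 [q1 pbq]]].
  exists Q, (proj1_sig q1), (cl_lift cl r Y ∘ proj1_sig q2); split.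
  + apply is_pullback_sym; rewrite <- eh; apply (is_pullback_paste (w2 := proj1_sig g')).
    * apply (cart_square_pullback_vert (X' := cl_ob cl r Y) (Y' := cl_ob cl r Z) (X := Y)
        (Y := Z)).
      -- apply (cl_cart cl r Y).
      -- apply (cl_cart cl r Z).
      -- symmetry; exact (reindexE cl r g).
      -- now rewrite !bs_cl.
      -- apply (bs_fiber g').
      -- apply bs_fiber.
    * now apply fiber_pullback_total.
  + intros k Hk.
    assert (ek : bs Q X k = r).
    { now rewrite <- (bs_fiber_l f k), Hk, bs_cl_vert. }
    destruct (cl_vert_ex cl ek) as [k' ek'].
    assert (Hk' : fmap (reindex cl r) f ∘ k' = q2).
    { apply cl_vert_inj; now rewrite reindex_compE, ek'. }
    destruct (ttf_is_dep_prod (reindex_ttf r) Ff Fg Fpi H) as [_ [_ HU]].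
    destruct (HU _ _ h' q1 q2 k' (is_pullback_sym pbq) Hk')
      as [u [[Hu [m [m1 [m2 m3]]]] Huniq]].
    exists (cl_lift cl r P ∘ proj1_sig u); split; [split|].
    * now rewrite <- reindex_compE, Hu.
    * exists (cl_lift cl r W ∘ proj1_sig m); rewrite <- !reindex_compE, m1, m2, m3.
      repeat split; auto; apply comp_assoc.
    * intros u0 [Hu0 [m0 [n1 [n2 n3]]]].
      assert (eu0 : bs V P u0 = r) by now rewrite <- (bs_fiber_l pi u0), Hu0.
      assert (em0 : bs Q W m0 = r) by now rewrite <- (bs_fiber_l w2 m0), n2, bs_cl_vert.
      destruct (cl_vert_ex cl eu0) as [u1 eu1], (cl_vert_ex cl em0) as [m1' em1].
      rewrite <- eu1; do 2 f_equal; apply Huniq; split.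
      -- apply cl_vert_inj; now rewrite reindex_compE, eu1, Hu0, eh.
      -- exists m1'; repeat split; apply cl_vert_inj; rewrite reindex_compE, em1.
         ++ rewrite n1, <- eu1; symmetry; apply comp_assoc.
         ++ exact n2.
         ++ now rewrite n3, ek'.
Qed.

Lemma vfib_dep_prod_ex (J : B) (X Y Z : fiber p J) (f : fo_ob X ~> fo_ob Y)
    (g : fo_ob Y ~> fo_ob Z) : vfib X Y f -> vfib Y Z g ->
  exists (P W : fiber p J) (pi : fo_ob P ~> fo_ob Z) (w1 : fo_ob W ~> fo_ob P)
    (w2 : fo_ob W ~> fo_ob Y) (e : fo_ob W ~> fo_ob X),
    vfib P Z pi /\ is_dep_prod f g pi w1 w2 e.
Proof.
intros [Hf Ff] [Hg Fg].
destruct (ttfc_dep_prod (fiber_ttfc J) Ff Fg) as [P [pi [Fpi [phi]]]].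
destruct (ttfc_pullback_ex (fiber_ttfc J) (vert Hg) Fpi) as [W [w1 [w2 pb]]].
pose proof (fiber_dep_prod_total Ff Fg Fpi (dep_prod_of_bijection phi pb)) as H.
exists P, W, (proj1_sig pi), (proj1_sig w1), (proj1_sig w2).
eexists; split; [now apply (vfibE pi)|exact H].
Qed.

Variable ra : forall (I J : B) (s : I ~> J), fibB s -> right_adjoint (reindex cl s).
Hypothesis ra_fib : forall (I J : B) (s : I ~> J) (hs : fibB s) (X Y : fiber p I) (f : X ~> Y),
  @fibF I X Y f -> @fibF J (ra hs X) (ra hs Y) (fmap (ra hs) f).
Hypothesis beck_chevalley : forall (I J I' J' : B) (s : I ~> J) (r : J' ~> J)
    (s' : I' ~> J') (t : I' ~> I) (sq : s ∘ t = r ∘ s') (hs : fibB s) (hs' : fibB s'),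
  is_pullback t s' s r ->
  forall A : fiber p I, is_iso (beck_chevalley_map sq (ra hs) (ra hs') A).

(** * Transposition between different bases through Beck-Chevalley *)

Section BeckChevalleyTranspose.
Variables (I J I' J' : B) (s : I ~> J) (r : J' ~> J) (s' : I' ~> J') (t : I' ~> I).
Variables (hs : fibB s) (pb : is_pullback t s' s r) (A : fiber p I).

(** Relates two transposes of a map from [V] to [s_* A] above [r]: composing its pullback [m] with
    the counit of [s] agrees with transposing, for [s'], its composite with the Beck-Chevalley map.
    As the latter is invertible, the next two lemmas obtain a bijection with maps from [s'^* V] to
    [A] above [t]. *)
Lemma beck_chevalley_transpose (hs' : fibB s') (V : fiber p J')
    (a : V ~> reindex cl r (ra hs A)) (m : fo_ob (cl_ob cl s' V) ~> fo_ob (cl_ob cl s (ra hs A))) :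
  bs (cl_ob cl s' V) (cl_ob cl s (ra hs A)) m = t ->
  cl_lift cl s (ra hs A) ∘ m = cl_lift cl r (ra hs A) ∘ proj1_sig a ∘ cl_lift cl s' V ->
  proj1_sig (ra_counit (ra hs) A) ∘ m =
  cl_lift cl t A ∘ proj1_sig (ra_counit (ra hs') (reindex cl t A) ∘
    fmap (reindex cl s') (beck_chevalley_map (proj1 pb) (ra hs) (ra hs') A ∘ a)).
Proof.
intros em Hm; set (sqr := reindex_square cl (proj1 pb) (ra hs A)).
assert (E1 : ra_counit (ra hs') (reindex cl t A) ∘
    fmap (reindex cl s') (beck_chevalley_map (proj1 pb) (ra hs) (ra hs') A ∘ a) =
    fmap (reindex cl t) (ra_counit (ra hs) A) ∘ (sqr ∘ fmap (reindex cl s') a)).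
{ unfold beck_chevalley_map; rewrite <- fmap_comp, (fmap_comp (reindex cl s')), comp_assoc.
  rewrite ra_transpose; symmetry; apply comp_assoc. }
rewrite E1, reindex_compE; f_equal.
apply (cart_inj (cl_cart cl s (ra hs A))).
- transitivity (cl_lift cl s (ra hs A) ∘ cl_lift cl t (cl_ob cl s (ra hs A)) ∘
    proj1_sig sqr ∘ proj1_sig (fmap (reindex cl s') a)).
  + unfold sqr; rewrite reindex_squareE, Hm, <- !comp_assoc; f_equal.
    symmetry; apply (reindexE cl s' a).
  + rewrite <- !comp_assoc; reflexivity.
- rewrite em; symmetry; apply bs_cl_vert.
Qed.

Lemma ra_transpose_total_ex (V : fiber p J') (k : fo_ob (cl_ob cl s' V) ~> fo_ob A) :
  bs (cl_ob cl s' V) A k = t ->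
  exists (a : fo_ob V ~> fo_ob (ra hs A)) (m : fo_ob (cl_ob cl s' V) ~> fo_ob (cl_ob cl s (ra hs A))),
    bs V (ra hs A) a = r /\ bs (cl_ob cl s' V) (cl_ob cl s (ra hs A)) m = t /\
    cl_lift cl s (ra hs A) ∘ m = a ∘ cl_lift cl s' V /\
    proj1_sig (ra_counit (ra hs) A) ∘ m = k.
Proof.
intros ek; pose proof (ttfc_pullback_fib base_ttfc pb hs) as hs'.
destruct (cl_vert_ex cl (X := reindex cl s' V) ek) as [k' ek'].
destruct (beck_chevalley (proj1 pb) hs hs' pb A) as [d [_ ed]].
set (a := d ∘ (fmap (ra hs') k' ∘ ra_unit (ra hs') V)).
destruct (@cl_lift_ex _ _ _ cl _ _ _ s t (cl_ob cl s' V) (ra hs A)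
  (cl_lift cl r (ra hs A) ∘ proj1_sig a ∘ cl_lift cl s' V)) as [m [m1 m2]].
{ rewrite (bs_comp (cl_ob cl s' V) V (ra hs A)), bs_cl_vert, bs_cl; symmetry; apply pb. }
exists (cl_lift cl r (ra hs A) ∘ proj1_sig a), m; split; [apply bs_cl_vert|].
split; [exact m2|split; [exact m1|]].
rewrite (beck_chevalley_transpose hs' m2 m1); unfold a.
now rewrite (comp_assoc _ d), ed, comp_idl, ra_transpose.
Qed.

Lemma ra_transpose_total_inj (V : fiber p J') (a b : fo_ob V ~> fo_ob (ra hs A))
    (m n : fo_ob (cl_ob cl s' V) ~> fo_ob (cl_ob cl s (ra hs A))) :
  bs V (ra hs A) a = r -> bs V (ra hs A) b = r ->
  bs (cl_ob cl s' V) (cl_ob cl s (ra hs A)) m = t ->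
  bs (cl_ob cl s' V) (cl_ob cl s (ra hs A)) n = t ->
  cl_lift cl s (ra hs A) ∘ m = a ∘ cl_lift cl s' V ->
  cl_lift cl s (ra hs A) ∘ n = b ∘ cl_lift cl s' V ->
  proj1_sig (ra_counit (ra hs) A) ∘ m = proj1_sig (ra_counit (ra hs) A) ∘ n -> a = b.
Proof.
intros ea eb em en Hm Hn H; pose proof (ttfc_pullback_fib base_ttfc pb hs) as hs'.
destruct (cl_vert_ex cl ea) as [a' <-], (cl_vert_ex cl eb) as [b' <-].
rewrite (beck_chevalley_transpose hs' em Hm), (beck_chevalley_transpose hs' en Hn) in H.
apply cl_vert_inj, ra_transpose_inj in H.
destruct (beck_chevalley (proj1 pb) hs hs' pb A) as [d [ed _]].
do 2 f_equal; rewrite <- (comp_idl a'), <- (comp_idl b'), <- ed, <- !comp_assoc.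
now f_equal.
Qed.

End BeckChevalleyTranspose.

(** Along a cartesian morphism over a fibration [s], the dependent product of
    [q : A ~> s^* Z] is the pullback of [s_* q] along the unit [Z ~> s_* s^* Z];
    its universal property against objects over an arbitrary base is the
    Beck-Chevalley condition. *)
Lemma cl_lift_dep_prod_ex (I J : B) (s : I ~> J) (Z : fiber p J) (A : fiber p I)
    (q : fo_ob A ~> fo_ob (cl_ob cl s Z)) : fibB s -> vfib A (cl_ob cl s Z) q ->
  exists (N : fiber p J) (pi : fo_ob N ~> fo_ob Z) (W : fiber p I) (w1 : fo_ob W ~> fo_ob N)
    (w2 : fo_ob W ~> fo_ob (cl_ob cl s Z)) (e : fo_ob W ~> fo_ob A),
    vfib N Z pi /\ is_dep_prod q (cl_lift cl s Z) pi w1 w2 e.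
Proof.
intros hs [Hq Fq].
set (q' := vert Hq : A ~> reindex cl s Z) in *.
set (eps := ra_counit (ra hs)); set (Rq := fmap (ra hs) q').
pose proof (ra_fib hs Fq : @fibF J _ _ Rq) as FRq.
set (eta := ra_unit (ra hs) Z).
destruct (ttfc_pullback_ex (fiber_ttfc J) eta FRq) as [N [b [pi pbN]]].
pose proof (fiber_pullback_total FRq pbN) as pbN'.
pose proof (ttfc_pullback_fib (fiber_ttfc J) pbN FRq) as Fpi.
exists N, (proj1_sig pi), (cl_ob cl s N), (cl_lift cl s N),
  (* The counit is the transpose of the projection [b] from [N] to [s_* A]. *)
  (proj1_sig (fmap (reindex cl s) pi)), (proj1_sig (eps A ∘ fmap (reindex cl s) b)).
split; [now apply vfibE|]; apply total_dep_prod_intro.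
- apply (cart_square_pullback_vert (X' := cl_ob cl s N) (Y' := cl_ob cl s Z)).
  + apply (cl_cart cl s N).
  + apply (cl_cart cl s Z).
  + symmetry; apply (reindexE cl s pi).
  + now rewrite !bs_cl.
  + apply (bs_fiber (fmap (reindex cl s) pi)).
  + apply bs_fiber.
- assert (H : q' ∘ (eps A ∘ fmap (reindex cl s) b) = fmap (reindex cl s) pi).
  { unfold eps; rewrite comp_assoc, <- ra_counit_nat, <- comp_assoc, <- fmap_comp.
    change (fmap (ra hs) q') with Rq; rewrite (proj1 pbN), fmap_comp, comp_assoc.
    unfold eta; now rewrite ra_triangle_l, comp_idl. }
  exact (f_equal (@proj1_sig _ _) H).
- intros K V h; set (r := bs V Z h).
  destruct (ttfc_pullback_ex base_ttfc r hs) as [I' [t [s' pb]]].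
  set (V' := cl_ob cl s' V).
  destruct (@cl_lift_ex _ _ _ cl _ _ _ s t V' Z (h ∘ cl_lift cl s' V)) as [q2 [e1 e2]].
  { rewrite (bs_comp V' V Z); unfold V'; rewrite bs_cl; symmetry; apply pb. }
  exists (fo_ob V'), (cl_lift cl s' V), q2; split.
  { apply (cart_square_pullback (X' := V') (X := V) (Y' := cl_ob cl s Z) (Y := Z)).
    - apply (cl_cart cl s' V).
    - apply (cl_cart cl s Z).
    - now symmetry.
    - unfold V' at 1; rewrite !bs_cl, e2; now apply is_pullback_sym. }
  intros k Hk.
  assert (ek : bs V' A k = t) by (rewrite <- (bs_fiber_l q' k); unfold q'; simpl; now rewrite Hk).
  destruct (ra_transpose_total_ex hs pb ek) as [a [m [ea [em [Hm Hem]]]]].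
  (* Both sides have transpose [q2]: the left one by naturality of the counit and [q ∘ k = q2], the
     right one by a triangle identity. *)
  assert (Ha : proj1_sig Rq ∘ a = proj1_sig eta ∘ h).
  { apply (ra_transpose_total_inj (s := s) (s' := s') (t := t) (r := r) (hs := hs) pb
      (A := reindex cl s Z)
      (m := proj1_sig (fmap (reindex cl s) Rq) ∘ m)
      (n := proj1_sig (fmap (reindex cl s) eta) ∘ q2)).
    - now rewrite bs_fiber_l.
    - now rewrite bs_fiber_l.
    - rewrite <- em; apply (bs_fiber_l (fmap (reindex cl s) Rq)).
    - rewrite <- e2; apply (bs_fiber_l (fmap (reindex cl s) eta)).
    - rewrite <- comp_assoc, <- Hm, !comp_assoc; f_equal; apply (reindexE cl s Rq).
    - rewrite <- comp_assoc, <- e1, !comp_assoc; f_equal; apply (reindexE cl s eta).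
    - pose proof (f_equal (@proj1_sig _ _) (ra_counit_nat (ra hs) q')) as H1.
      pose proof (f_equal (@proj1_sig _ _) (ra_triangle_l (ra hs) Z)) as H2.
      transitivity q2; rewrite comp_assoc.
      + transitivity (q ∘ proj1_sig (eps A) ∘ m); [exact (f_equal (fun x => x ∘ m) H1)|].
        now rewrite <- comp_assoc; unfold eps; rewrite Hem.
      + transitivity (idm _ ∘ q2); [now rewrite comp_idl|].
        symmetry; exact (f_equal (fun x => x ∘ q2) H2). }
  destruct (is_pullback_lift pbN' Ha) as [u [Hu1 Hu2]].
  assert (eu : bs V N u = r) by now rewrite <- (bs_fiber_l pi u), Hu2.
  exists u; split; [split; [exact Hu2|]|].
  + destruct (@cl_lift_ex _ _ _ cl _ _ _ s t V' N (u ∘ cl_lift cl s' V)) as [m' [m1 m2]].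
    { rewrite (bs_comp V' V N), eu; unfold V'; rewrite bs_cl; symmetry; apply pb. }
    exists m'; split; [exact m1|split].
    * apply (cart_inj (cl_cart cl s Z)).
      -- etransitivity; [exact (reindex_totalE (V := V') pi m')|].
         now rewrite m1, comp_assoc, Hu2.
      -- rewrite e2, <- m2; apply (bs_fiber_l (fmap (reindex cl s) pi)).
    * rewrite <- Hem; transitivity (proj1_sig (eps A) ∘ (proj1_sig (fmap (reindex cl s) b) ∘ m')).
      { symmetry; apply comp_assoc. }
      f_equal; apply (cart_inj (cl_cart cl s (ra hs A))).
      -- etransitivity; [exact (reindex_totalE (V := V') b m')|].
         now rewrite m1, comp_assoc, Hu1.
      -- transitivity t; [rewrite <- m2; apply (bs_fiber_l (fmap (reindex cl s) b))|now symmetry].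
  + intros u0 [Hu0 [m0 [n1 [n2 n3]]]].
    apply (is_pullback_inj pbN'); [|now rewrite Hu0].
    assert (eu0 : bs V N u0 = r) by now rewrite <- (bs_fiber_l pi u0), Hu0.
    assert (em0 : bs V' (cl_ob cl s N) m0 = t).
    { rewrite <- e2, <- n2; symmetry; apply (bs_fiber_l (fmap (reindex cl s) pi)). }
    rewrite Hu1.
    (* [a] and [b ∘ u0] coincide because both have transpose [k]. *)
    apply (ra_transpose_total_inj (hs := hs) pb (m := m)
      (n := proj1_sig (fmap (reindex cl s) b) ∘ m0)); auto.
    * now rewrite bs_fiber_l.
    * rewrite <- em0; apply (bs_fiber_l (fmap (reindex cl s) b)).
    * etransitivity; [exact (reindex_totalE (V := V') b m0)|].
      now rewrite n1, comp_assoc.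
    * rewrite Hem, <- n3; symmetry; apply comp_assoc.
Qed.

(** Hides the chosen lifting: only a cartesian [c] remains, fixed before [q], so that it can serve
    to build the [q] to which the property is then applied. *)
Lemma cartesian_dep_prod_ex (I J : B) (s : I ~> J) (Z : fiber p J) : fibB s ->
  exists (U : fiber p I) (c : fo_ob U ~> fo_ob Z), cartesian p c /\ bs U Z c = s /\
  forall (A : fiber p I) (q : fo_ob A ~> fo_ob U), vfib A U q ->
  exists (N : fiber p J) (pi : fo_ob N ~> fo_ob Z) (W : fiber p I) (w1 : fo_ob W ~> fo_ob N)
    (w2 : fo_ob W ~> fo_ob U) (e : fo_ob W ~> fo_ob A),
    vfib N Z pi /\ is_dep_prod q c pi w1 w2 e.
Proof.
intros hs; exists (cl_ob cl s Z), (cl_lift cl s Z).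
split; [apply (cl_cart cl s Z)|split; [apply (bs_cl cl s Z)|]].
intros A q; now apply cl_lift_dep_prod_ex.
Qed.

(** Write [Z' = pi^* Z], [Y' = w2^* Y], [X' = eps^* X]. The dependent product of
    [f] along [g] is that of the vertical part [X' ~> Y'] of [f] along the
    pullback [Y' ~> Z'] of [g], composed with [Z' ~> Z]: a map from the pullback
    of [V ~> Z] to [X] over [Y] first determines, in the base, a map from [V] to
    the dependent product [P] above [Z]. *)
Lemma rfib_dep_prod_ex (I J K P W : B) (X : fiber p I) (Y : fiber p J) (Z : fiber p K)
    (f : fo_ob X ~> fo_ob Y) (g : fo_ob Y ~> fo_ob Z)
    (pi : P ~> K) (w1 : W ~> P) (w2 : W ~> J) (eps : W ~> I) :
  rfib X Y f -> rfib Y Z g -> fibB pi ->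
  is_dep_prod (bs X Y f) (bs Y Z g) pi w1 w2 eps ->
  exists (N : fiber p P) (n : fo_ob N ~> fo_ob Z) (M : E) (m1 : M ~> fo_ob N)
    (m2 : M ~> fo_ob Y) (e : M ~> fo_ob X),
    rfib N Z n /\ bs N Z n = pi /\ is_dep_prod f g n m1 m2 e /\
    is_dep_prod (bs X Y f) (bs Y Z g) (bs N Z n) (bs (self p M) N m1) (bs (self p M) Y m2)
      (bs (self p M) X e).
Proof.
intros Hf Hg Fpi HB; pose proof HB as [pbB [eB UB]].
destruct (cartesian_ex cl pi Z) as [Z' [z [Hz ez]]].
destruct (cartesian_ex cl w2 Y) as [Y' [y [Hy ey]]].
destruct (cartesian_ex cl eps X) as [X' [x [Hx ex]]].
destruct (@cart_lift _ _ _ _ _ _ Z' Z z Y' (g ∘ y) w1 Hz) as [g1 [eg1 bg1]].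
{ rewrite (bs_comp Y' Y Z), ey, ez; symmetry; apply pbB. }
destruct (@cart_lift _ _ _ _ _ _ Y' Y y X' (f ∘ x) (idm W) Hy) as [f' [ef' bf']].
{ now rewrite (bs_comp X' X Y), ey, ex, comp_idr. }
assert (Vf' : vfib X' Y' f').
{ apply (vfib_of_rfib (X := X) (Y := Y) (x := x) (y := y) (f := f)); auto. }
assert (pbg : is_pullback g1 y z g).
{ apply is_pullback_sym, (cart_square_pullback (X' := Y') (X := Y) (Y' := Z') (Y := Z)); auto.
  rewrite ey, ez, bg1; now apply is_pullback_sym. }
assert (Fw1 : fibB w1).
{ apply (ttfc_pullback_fib base_ttfc (is_pullback_sym pbB)), Hg. }
(* Splits [g1] as a vertical [g2] followed by a cartesian [c] above [w1]; the dependent product is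
   taken along [g2] in the fiber over [W], then along [c]. *)
destruct (cartesian_dep_prod_ex Z' Fw1) as [U [c [Hc [ec HC]]]].
destruct (@cart_lift _ _ _ _ _ _ U Z' c Y' g1 (idm W) Hc) as [g2 [eg2 bg2]].
{ now rewrite ec, comp_idr. }
assert (ezc : z ∘ c ∘ g2 = g ∘ y) by now rewrite <- comp_assoc, eg2, eg1.
assert (Vg2 : vfib Y' U g2).
{ apply (vfib_of_rfib (X := Y) (Y := Z) (x := y) (y := z ∘ c) (f := g)); auto.
  now apply (cartesian_comp (X := U) (Y := Z') (Z := Z)). }
destruct (vfib_dep_prod_ex Vf' Vg2) as [Q [T [q [t1 [t2 [d [Vq HQ]]]]]]].
destruct (HC _ _ Vq) as [N [n' [S [s1 [s2 [e' [Vn' HN]]]]]]].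
destruct (dep_prod_comp (f := f') (g := g2) (c := c) (pi := n') (d := d) (e := e')
  (q := q) (v1 := t1) (v2 := t2) (w1 := s1) (w2 := s2)) as [M [m1 [m2 [k HM]]]]; auto.
{ intros V h.
  destruct (rfib_pullback_ex (Y := self p V) h (rfib_vfib Vg2))
    as [? [? [? [M [a [b [_ [pb _]]]]]]]].
  exists M, b, a; now apply is_pullback_sym. }
{ intros V h.
  destruct (rfib_pullback_ex (X := U) (Z := Z') (f := c) (Y := self p V) h)
    as [? [? [? [M [a [b [_ [pb _]]]]]]]].
  { apply rfib_cartesian; [exact Hc|now rewrite ec]. }
  exists M, b, a; now apply is_pullback_sym. }
rewrite eg2 in HM; destruct HM as [pbM [eM UM]].
assert (en : bs N Z (z ∘ n') = pi) by now rewrite (bs_vfib_l (Y := Z) z Vn').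
assert (Hn : rfib N Z (z ∘ n')).
{ apply (rfib_comp (Y := Z')); [|now apply rfib_vfib].
  apply rfib_cartesian; [exact Hz|now rewrite ez]. }
assert (pbM' : is_pullback m1 (y ∘ m2) (z ∘ n') g).
{ apply is_pullback_sym, (is_pullback_paste (w2 := g1)); now apply is_pullback_sym. }
exists N, (z ∘ n'), M, m1, (y ∘ m2), (x ∘ k); split; [exact Hn|split; [exact en|split]].
- apply total_dep_prod_intro; [exact pbM'| |].
  { now rewrite comp_assoc, <- ef', <- comp_assoc, eM. }
  intros L V h.
  destruct (rfib_pullback_ex h Hg) as [L' [_ [_ [T0 [q2 [q1 [_ [pb _]]]]]]]].
  apply is_pullback_sym in pb; exists (fo_ob T0), q1, q2; split; [exact pb|].
  intros l Hl.
  pose proof (proj2 (rfib_pullback (X := Y) (Y := V) (Z := Z) (W := T0) Hg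
    (is_pullback_sym pb))) as pb'; apply is_pullback_sym in pb'.
  assert (Hl' : bs X Y f ∘ bs T0 X l = bs T0 Y q2) by now rewrite <- bs_comp, Hl.
  (* With the base solution [r] and its pullback [m0] known, [h], [q2] and [l] lift to [Z'], [Y']
     and [X'], which reduces the problem to the dependent product along [g1]. *)
  destruct (UB _ _ _ _ _ _ pb' Hl') as [r [[Hr [m0 [r1 [r2 r3]]]] Hruniq]].
  destruct (@cart_lift _ _ _ _ _ _ Z' Z z V h r Hz) as [h' [eh' bh']].
  { now rewrite ez. }
  destruct (@cart_lift _ _ _ _ _ _ Y' Y y T0 q2 m0 Hy) as [q2' [eq2' bq2']].
  { now rewrite ey. }
  destruct (@cart_lift _ _ _ _ _ _ X' X x T0 l m0 Hx) as [l' [el' bl']].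
  { now rewrite ex. }
  assert (Hl1 : f' ∘ l' = q2').
  { apply (cart_inj (X' := Y') (X := Y) (V := T0) Hy).
    - now rewrite comp_assoc, ef', <- comp_assoc, el', Hl, eq2'.
    - now rewrite (bs_vfib_r (V := T0) l' Vf'), bl', bq2'. }
  assert (pbq : is_pullback q1 q2' h' g1).
  { apply is_pullback_sym, (is_pullback_cancel (w1 := y) (w2 := g1) (f := g) (g := z)).
    - now apply is_pullback_sym.
    - apply (cart_inj (X' := Z') (X := Z) (V := T0) Hz).
      + rewrite !comp_assoc, eg1, eh', <- comp_assoc, eq2'; symmetry; apply pb.
      + now rewrite (bs_comp T0 Y' Z'), (bs_comp T0 V Z'), bg1, bq2', bh', r1.
    - rewrite eq2', eh'; now apply is_pullback_sym. }
  destruct (UM _ _ _ _ _ _ pbq Hl1) as [u [[Hu [m [n1 [n2 n3]]]] Huniq]].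
  exists u; split; [split|].
  + now rewrite <- comp_assoc, Hu.
  + exists m; rewrite <- !comp_assoc, n1, n2, n3; auto.
  + intros u' [Hu' [m' [n1' [n2' n3']]]].
    rewrite <- comp_assoc in Hu'; rewrite <- comp_assoc in n2'; rewrite <- comp_assoc in n3'.
    assert (bk : bs T0 Y' (m2 ∘ m') = bs T0 X' (k ∘ m')).
    { now rewrite <- eM, <- comp_assoc, (bs_vfib_r (V := T0) (k ∘ m') Vf'). }
    assert (R1 : w1 ∘ bs T0 Y' (m2 ∘ m') = bs V Z' (n' ∘ u') ∘ bs T0 V q1).
    { rewrite <- bg1, <- !bs_comp; f_equal.
      now rewrite <- comp_assoc, <- n1', !comp_assoc, (proj1 pbM). }
    assert (R2 : w2 ∘ bs T0 Y' (m2 ∘ m') = bs T0 Y q2).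
    { now rewrite <- ey, <- bs_comp, n2'. }
    (* The base component of a competing solution solves the base problem, hence equals [r]; only
       then can uniqueness above [Z'] be applied. *)
    assert (er : bs V Z' (n' ∘ u') = r).
    { symmetry; apply Hruniq; split; [now rewrite <- ez, <- bs_comp, Hu'|].
      exists (bs T0 Y' (m2 ∘ m')); repeat split; auto.
      now rewrite bk, <- ex, <- bs_comp, n3'. }
    assert (em0 : bs T0 Y' (m2 ∘ m') = m0).
    { apply (is_pullback_inj pbB); [now rewrite R1, r1, er|now rewrite R2]. }
    apply Huniq; split.
    * apply (cart_inj Hz); [now rewrite Hu'|now rewrite er].
    * exists m'; split; [exact n1'|split].
      -- apply (cart_inj (X' := Y') (X := Y) (V := T0) Hy); [now rewrite n2'|now rewrite em0].
      -- apply (cart_inj (X' := X') (X := X) (V := T0) Hx); [now rewrite n3'|].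
         now rewrite <- bk, em0.
- assert (pbself := proj2 (rfib_pullback (X := N) (Y := Y) (Z := Z) (W := self p M) Hn pbM')).
  rewrite en in *.
  (* The object [N] lies above [P] itself, so only the choice of pullback of [pi] differs from the
     given base dependent product. *)
  apply (dep_prod_transport (a := idm P) (b := bs (self p M) Y' m2) HB).
  + apply is_iso_id.
  + apply comp_idr.
  + exact pbself.
  + rewrite comp_idl, <- bg1, <- (bs_comp (self p M) Y' Z').
    rewrite <- (bs_vfib_r (V := self p M) m1 Vn'); f_equal; symmetry; apply pbM.
  + now rewrite <- ey, <- (bs_comp (self p M) Y' Y).
  + transitivity (eps ∘ bs (self p M) X' k).
    * rewrite <- eM; f_equal; exact (bs_vfib_r (V := self p M) k Vf').
    * rewrite <- ex; symmetry; exact (bs_comp (self p M) X' X x k).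
Qed.

(** * Acyclic cofibrations and factorizations *)

Lemma reedy_acof_intro (A B' : E) (i : A ~> B') :
  (forall (I J : B) (X : fiber p I) (Y : fiber p J) (q : fo_ob X ~> fo_ob Y),
    rfib X Y q -> left_lifting i q) ->
  acyclic_cofibration (reedy_fibration cl fibB fibF) i.
Proof.
intros H C D q Hq; apply (H _ _ (self p C) (self p D)).
now apply (reedyE (X := self p C) (Y := self p D)).
Qed.

(** Since [i] is vertical, the base component [u] of [f] is already that of the diagonal. After
    lifting [g] through the cartesian part of [q], reindexing the vertical part along [u] turns the
    problem into one in the fiber over [I]. *)
Lemma fiber_acof_total (I : B) (X Y : fiber p I) (i : X ~> Y) :
  acyclic_cofibration (@fibF I) i ->
  acyclic_cofibration (reedy_fibration cl fibB fibF) (proj1_sig i).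
Proof.
intros Hi; apply reedy_acof_intro.
intros K L C D q [_ [D1 [c [v [Hc [Hv Hq]]]]]] f g e; set (u := bs X C f).
destruct (cart_lift (V := Y) (g := g) (r := u) Hc) as [g1 [eg1 bg1]].
{ unfold u; rewrite <- (bs_vfib_l (Y := D) c Hv), Hq, <- bs_comp, e.
  now rewrite (bs_comp X Y D), bs_fiber, comp_idr. }
destruct Hv as [Hv Fv].
destruct (cl_vert_ex cl (eq_refl u : bs X C f = u)) as [f' ef].
destruct (cl_vert_ex cl bg1) as [g' eg].
destruct (Hi _ _ _ (ttf_fib (reindex_ttf u) Fv) f' g') as [h [h1 h2]].
{ apply cl_vert_inj; rewrite reindex_compE, ef.
  change (v ∘ f = cl_lift cl u D1 ∘ (proj1_sig g' ∘ proj1_sig i)).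
  rewrite comp_assoc, eg; apply (cart_inj Hc).
  - now rewrite !comp_assoc, eg1, <- e, Hq.
  - now rewrite (bs_comp X Y D1), bs_fiber, bg1, comp_idr, (bs_comp X C D1), Hv, comp_idl. }
exists (cl_lift cl u C ∘ proj1_sig h); split.
- rewrite <- ef, <- h1; symmetry; apply comp_assoc.
- rewrite <- Hq, <- eg1, <- eg, <- h2, <- comp_assoc; f_equal.
  exact (eq_sym (reindex_compE (vert Hv) h)).
Qed.

Hypothesis weakly_cartesian_fib : forall (I J : B) (s : I ~> J), acyclic_cofibration fibB s ->
  forall (X Y : fiber p J) (f : X ~> Y), @fibF J X Y f -> weakly_cartesian (reindex cl s) f.

(** Weak cartesianness as a lifting property: [k] corresponds to a map [k'] from [s^* A] to [s^* X],
    and a map [h] with reindexing [k'] and [f ∘ h = g] is a diagonal. *)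
Lemma vfib_lift_cartesian (I J : B) (A X Y : fiber p J) (A' : fiber p I)
    (i : fo_ob A' ~> fo_ob A) (f : fo_ob X ~> fo_ob Y) (g : fo_ob A ~> fo_ob Y)
    (k : fo_ob A' ~> fo_ob X) :
  cartesian p i -> acyclic_cofibration fibB (bs A' A i) -> vfib X Y f ->
  bs A Y g = idm J -> f ∘ k = g ∘ i ->
  exists h : fo_ob A ~> fo_ob X, bs A X h = idm J /\ h ∘ i = k /\ f ∘ h = g.
Proof.
intros Hi; set (s := bs A' A i); intros Hs [Hf Ff] Hg e.
destruct (cartesian_unique (X := cl_ob cl s A) (X' := A') (cl_cart cl s A) Hi)
  as [b [[b' [eb eb']] [ib vb]]]; [now rewrite bs_cl|].
assert (ek : bs A' X k = s).
{ rewrite <- (comp_idl (bs A' X k)), <- Hf, <- bs_comp, e, (bs_comp A' A Y), Hg; apply comp_idl. }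
destruct (cl_vert_ex cl (X := cl_ob cl s A) (Y := X) (s := s) (g := k ∘ b)) as [k' ek'].
{ now rewrite (bs_comp (cl_ob cl s A) A' X), vb, ek, comp_idr. }
destruct (@weakly_cartesian_fib _ _ s Hs X Y (vert Hf) Ff A (vert Hg) k') as [h [h1 h2]].
{ apply cl_vert_inj; etransitivity; [exact (reindex_compE (vert Hf) k')|].
  etransitivity; [|symmetry; exact (reindexE cl s (vert Hg))].
  change (f ∘ (cl_lift cl s X ∘ proj1_sig k') = g ∘ cl_lift cl s A).
  now rewrite ek', comp_assoc, e, <- comp_assoc, ib. }
exists (proj1_sig h); split; [apply bs_fiber|split].
- rewrite <- (comp_idr (proj1_sig h ∘ i)), <- (comp_idr k), <- eb', !comp_assoc; f_equal.
  rewrite (comp_eq_l _ ib), <- ek', <- h2; symmetry; apply reindexE.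
- exact (f_equal (@proj1_sig _ _) h1).
Qed.

Lemma cartesian_acof_total (I J : B) (A' : fiber p I) (A : fiber p J)
    (i : fo_ob A' ~> fo_ob A) :
  cartesian p i -> acyclic_cofibration fibB (bs A' A i) ->
  acyclic_cofibration (reedy_fibration cl fibB fibF) i.
Proof.
intros Hi Hs; apply reedy_acof_intro.
intros K L C D q [Fq [D1 [c [v [Hc [Hv Hq]]]]]] f g e.
(* The diagonal is found in the base first; reindexed along [u], the problem becomes one against a
   vertical fibration with vertical bottom map. *)
destruct (Hs _ _ _ Fq (bs A' C f) (bs A D g)) as [u [u1 u2]].
{ now rewrite <- !bs_comp, e. }
destruct (cart_lift (V := A) (g := g) (r := u) Hc) as [g1 [eg1 bg1]].
{ now rewrite <- (bs_vfib_l (Y := D) c Hv), Hq. }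
destruct (cl_vert_ex cl bg1) as [g' eg].
destruct (@cl_lift_ex _ _ _ cl _ _ _ u (bs A' A i) A' C f (eq_sym u1)) as [f' [ef bf]].
destruct Hv as [Hv Fv].
set (v' := fmap (reindex cl u) (vert Hv)).
pose proof (ttf_fib (reindex_ttf u) Fv : @fibF _ _ _ v') as Fv'; apply vfibE in Fv'.
destruct (vfib_lift_cartesian (A := A) (k := f') (g := proj1_sig g') Hi Hs Fv')
  as [h [h1 [h2 h3]]].
{ apply bs_fiber. }
{ apply (cart_inj (cl_cart cl u D1)).
  - etransitivity; [exact (reindex_totalE (V := A') (vert Hv) f')|]; simpl.
    transitivity (g1 ∘ i); [|rewrite <- eg; symmetry; apply comp_assoc].
    rewrite ef; apply (cart_inj Hc).
    + now rewrite !comp_assoc, eg1, <- e, Hq.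
    + now rewrite (bs_comp A' A D1), bg1, u1, (bs_comp A' C D1), Hv, comp_idl.
  - etransitivity; [exact (bs_vfib_r (V := A') f' Fv')|].
    transitivity (bs A' A i); [exact bf|]; symmetry.
    exact (bs_fiber_l (V := A') g' i). }
exists (cl_lift cl u C ∘ h); split.
- now rewrite <- ef, <- h2, comp_assoc.
- rewrite <- Hq, <- eg1, <- eg, <- h3, <- comp_assoc; f_equal.
  exact (eq_sym (reindex_totalE (V := A) (vert Hv) h)).
Qed.

Lemma reedy_factorization (A C : E) (f : A ~> C) :
  exists (N : E) (j : A ~> N) (q : N ~> C),
    acyclic_cofibration (reedy_fibration cl fibB fibF) j /\
    reedy_fibration cl fibB fibF q /\ f = q ∘ j.
Proof.
destruct (ttfc_factor base_ttfc (fmap p f)) as [M [i [q [Hi [Hq e]]]]].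
destruct (ttfc_terminal base_ttfc) as [T HT].
destruct (HT (p A)) as [tA _], (HT M) as [tM _].
(* The retraction lifts the identity of [p A] against the fibration from [p A] to the terminal
   object. *)
destruct (Hi _ _ tA (ttfc_to_terminal base_ttfc tA HT) (idm _) tM) as [r [er _]].
{ now apply is_terminal_inj. }
set (A1 := cl_ob cl r (self p A)); set (C1 := cl_ob cl q (self p C)).
destruct (@cl_lift_ex _ _ _ cl _ _ _ r i (self p A) (self p A) (idm A)) as [j [ej bj]].
{ rewrite er; exact (bs_id (self p A)). }
assert (Hj : cartesian p j).
{ apply (cartesian_cancel (X := self p A) (Y := A1) (Z := self p A)
    (d := cl_lift cl r (self p A))); [apply (cl_cart cl r)|].
  unfold A1; rewrite ej; apply (cartesian_iso (X := self p A) (Y := self p A)), is_iso_id. }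
destruct (@cl_lift_ex _ _ _ cl _ _ _ q i (self p A) (self p C) f) as [k [ek bk]].
{ now rewrite bs_self. }
destruct (ttfc_terminal (fiber_ttfc M)) as [T1 HT1].
destruct (fiber_terminal_lift (idm M) A1 HT1) as [g bg].
destruct (HT1 C1) as [tC _].
(* [C1] is fibrant in the fiber over [M], so [k] extends along [j] to a vertical [h]; factoring [h]
   in that fiber completes the construction. *)
destruct (vfib_lift_cartesian (A' := self p A) (A := A1) (X := C1) (Y := T1)
  (f := proj1_sig tC) (g := g) (k := k) Hj) as [h [bh [hj _]]].
{ unfold A1; now rewrite bj. }
{ now apply vfibE, (ttfc_to_terminal (fiber_ttfc M)). }
{ exact bg. }
{ apply (fiber_terminal_inj (V := self p A) HT1).
  etransitivity; [exact (bs_fiber_l (V := self p A) tC k)|].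
  transitivity i; [exact bk|]; symmetry; etransitivity; [exact (bs_comp (self p A) A1 T1 g j)|].
  rewrite bg, comp_idl; exact bj. }
destruct (ttfc_factor (fiber_ttfc M) (vert bh)) as [N [a [b [Ha [Hb eh]]]]].
exists (fo_ob N), (proj1_sig a ∘ j), (cl_lift cl q (self p C) ∘ proj1_sig b); split; [|split].
- apply acyclic_cofibration_comp; [|now apply fiber_acof_total].
  apply (cartesian_acof_total (A' := self p A) (A := A1) Hj); unfold A1; now rewrite bj.
- apply (reedyE (X := N) (Y := self p C)), (rfib_intro (Y' := C1)
    (c := cl_lift cl q (self p C)) (v := proj1_sig b)); auto.
  + apply (cl_cart cl q).
  + unfold C1; now rewrite bs_cl.
  + now apply vfibE.
- pose proof (f_equal (@proj1_sig _ _) eh) as eh'; simpl in eh'.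
  rewrite <- ek, <- hj, eh', <- !comp_assoc; reflexivity.
Qed.

(** Uses the fibrewise terminal objects, which form a right adjoint of [p]
    taking fibrations to Reedy fibrations. *)
Lemma fmap_acof (A C : E) (i : A ~> C) :
  acyclic_cofibration (reedy_fibration cl fibB fibF) i -> acyclic_cofibration fibB (fmap p i).
Proof.
intros Hi X Y q Hq f g e.
destruct (ttfc_terminal (fiber_ttfc X)) as [TX HX].
destruct (ttfc_terminal (fiber_ttfc Y)) as [TY HY].
destruct (fiber_terminal_lift q TX HY) as [q' bq].
destruct (fiber_terminal_lift f (self p A) HX) as [f' bf].
destruct (fiber_terminal_lift g (self p C) HY) as [g' bg].
destruct (cl_vert_ex cl bq) as [u eu].
(* The vertical part of [q'] has terminal codomain, as reindexing keeps [TY] terminal. *)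
assert (Rq : reedy_fibration cl fibB fibF q').
{ apply reedyE, (rfib_cl bq eu); split; [exact Hq|].
  apply (ttfc_to_terminal (fiber_ttfc X)), (ttf_terminal (reindex_ttf q) HY). }
destruct (Hi _ _ _ Rq f' g') as [h [h1 h2]].
{ apply (fiber_terminal_inj (V := self p A) HY).
  transitivity (q ∘ f); [rewrite <- bq, <- bf; exact (bs_comp (self p A) TX TY q' f')|].
  rewrite e, <- bg, <- (bs_self p i); symmetry; exact (bs_comp (self p A) (self p C) TY g' i). }
exists (bs (self p C) TX h); split.
- rewrite <- bf, <- h1, <- (bs_self p i); symmetry.
  exact (bs_comp (self p A) (self p C) TX h i).
- rewrite <- bq, <- bg, <- h2; symmetry; exact (bs_comp (self p C) TX TY q' h).
Qed.

(** * The total category *)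

(** With [d] cartesian above the base of [f], the composite [c ∘ d] is cartesian, so [f] and [c ∘ f]
    share the vertical part [v]. This gives the condition on induced morphisms in [fibred_ttfc]. *)
Lemma rfib_cancel_cartesian (I J K : B) (X : fiber p I) (Y : fiber p J) (Z : fiber p K)
    (c : fo_ob Y ~> fo_ob Z) (f : fo_ob X ~> fo_ob Y) :
  cartesian p c -> fibB (bs X Y f) -> rfib X Z (c ∘ f) -> rfib X Y f.
Proof.
intros Hc Ff Hcf; destruct (cartesian_ex cl (bs X Y f) Y) as [Y1 [d [Hd ed]]].
destruct (cart_lift (g := f) (r := idm I) Hd) as [v [ev bv]]; [now rewrite ed, comp_idr|].
apply (rfib_intro (c := d) (v := v)); auto; [now rewrite ed|].
apply (vfib_of_rfib (X := X) (Y := Z) (x := idm _) (y := c ∘ d) (f := c ∘ f)); auto.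
- apply (cartesian_iso (X := X) (Y := X)), is_iso_id.
- apply (cartesian_comp (X := Y1) (Y := Y) (Z := Z)); auto.
- now rewrite comp_idr, <- comp_assoc, ev.
Qed.

Lemma reedy_dep_prod_ex (X Y Z : E) (f : X ~> Y) (g : Y ~> Z) :
  reedy_fibration cl fibB fibF f -> reedy_fibration cl fibB fibF g ->
  exists (P W : E) (pi : P ~> Z) (w1 : W ~> P) (w2 : W ~> Y) (e : W ~> X),
    reedy_fibration cl fibB fibF pi /\ is_dep_prod f g pi w1 w2 e /\
    is_dep_prod (fmap p f) (fmap p g) (fmap p pi) (fmap p w1) (fmap p w2) (fmap p e).
Proof.
intros Hf Hg.
destruct (ttfc_dep_prod base_ttfc (proj1 Hf) (proj1 Hg)) as [P0 [pi0 [F0 [phi0]]]].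
destruct (ttfc_pullback_ex base_ttfc (fmap p g) F0) as [W0 [w1 [w2 pb0]]].
pose proof (dep_prod_of_bijection phi0 pb0) as H0.
(* The counit term mentions [fmap p f] and [fmap p g] in its types; abstracting it makes the
   following rewrites well typed. *)
generalize dependent (proj1_sig (dpb_map phi0 pb0 (slice_id pi0))); intros e0 H0.
apply (reedyE (X := self p X) (Y := self p Y)) in Hf.
apply (reedyE (X := self p Y) (Y := self p Z)) in Hg.
rewrite <- (bs_self p f), <- (bs_self p g) in H0.
destruct (rfib_dep_prod_ex Hf Hg F0 H0) as [N [n [M [m1 [m2 [e [Hn [_ [HE HB]]]]]]]]].
destruct N as [N eN]; destruct eN; simpl in *.
exists N, M, n, m1, m2, e; split; [now apply (reedyE (X := self p N) (Y := self p Z))|].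
split; [exact HE|].
rewrite <- (bs_self p f), <- (bs_self p g), <- (bs_self p n), <- (bs_self p m1),
  <- (bs_self p m2), <- (bs_self p e); exact HB.
Qed.

Lemma reedy_pullback_ex (X Y Z : E) (f : X ~> Z) (g : Y ~> Z) :
  reedy_fibration cl fibB fibF f ->
  exists (W : E) (w1 : W ~> X) (w2 : W ~> Y), is_pullback w1 w2 f g.
Proof.
intros Hf; apply (reedyE (X := self p X) (Y := self p Z)) in Hf.
destruct (@rfib_pullback_ex _ _ _ (self p X) (self p Z) (self p Y) f g Hf) as [? [? [? [W [w1 [w2 [_ [pb _]]]]]]]].
now exists (fo_ob W), w1, w2.
Qed.

Lemma reedy_pullback (W X Y Z : E) (w1 : W ~> X) (w2 : W ~> Y) (f : X ~> Z) (g : Y ~> Z) :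
  reedy_fibration cl fibB fibF f -> is_pullback w1 w2 f g ->
  reedy_fibration cl fibB fibF w2 /\
  is_pullback (fmap p w1) (fmap p w2) (fmap p f) (fmap p g).
Proof.
intros Hf pb; apply (reedyE (X := self p X) (Y := self p Z)) in Hf.
destruct (@rfib_pullback _ _ _ _ (self p W) (self p X) (self p Y) (self p Z) w1 w2 f g Hf pb) as [H1 H2]; split.
- now apply (reedyE (X := self p W) (Y := self p Y)).
- rewrite <- (bs_self p w1), <- (bs_self p w2), <- (bs_self p f), <- (bs_self p g); exact H2.
Qed.

Lemma reedy_ttfc : is_ttfc (reedy_fibration cl fibB fibF).
Proof.
split.
- destruct total_terminal_ex as [J [T [_ [_ HT]]]]; now exists (fo_ob T).
- intros X Y Z g f Hg Hf; apply (reedyE (X := self p X) (Y := self p Z)).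
  apply (@rfib_comp _ _ _ (self p X) (self p Y) (self p Z)).
  + now apply (reedyE (X := self p Y) (Y := self p Z)).
  + now apply (reedyE (X := self p X) (Y := self p Y)).
- intros X Y f Hf; now apply (reedyE (X := self p X) (Y := self p Y)), rfib_iso.
- intros A T f HT; now apply (reedyE (X := self p A) (Y := self p T)), rfib_to_terminal.
- exact reedy_pullback_ex.
- intros W X Y Z w1 w2 f g pb Hf; exact (proj1 (reedy_pullback Hf pb)).
- exact reedy_factorization.
- intros X Y Z f g Hf Hg.
  destruct (reedy_dep_prod_ex Hf Hg) as [P [W [pi [w1 [w2 [e [Hpi [H _]]]]]]]].
  exists P, pi; split; [exact Hpi|]; exact (inhabits (bijection_of_dep_prod H)).
Qed.

Lemma projection_ttf : type_theoretic_functor (reedy_fibration cl fibB fibF) fibB p.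
Proof.
split.
- exact fmap_terminal.
- now intros A C f [Hf _].
- intros W X Y Z w1 w2 f g Hf pb; exact (proj2 (reedy_pullback Hf pb)).
- exact fmap_acof.
- intros X Y Z P f g pi phi Hf Hg Hpi.
  destruct (reedy_pullback_ex g Hpi) as [W [w1 [w2 pb]]].
  apply (preserves_dep_prod_bijection (pb := pb)).
  destruct (reedy_dep_prod_ex Hf Hg) as [P0 [W0 [pi0 [v1 [v2 [e [_ [H HB]]]]]]]].
  (* The given dependent product is compared with the constructed one, whose image under [p] is
     known to be a dependent product. *)
  destruct (dep_prod_unique (dep_prod_of_bijection phi pb) H)
    as [a [b [Ha [e1 [e2 [e3 e4]]]]]].
  apply (dep_prod_transport (a := fmap p a) (b := fmap p b) HB).
  + now apply fmap_iso.
  + now rewrite <- fmap_comp, e1.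
  + exact (proj2 (reedy_pullback Hpi pb)).
  + now rewrite <- !fmap_comp, e2.
  + now rewrite <- fmap_comp, e3.
  + now rewrite <- fmap_comp, e4.
Qed.

Lemma reedy_fibred_ttfc : fibred_ttfc cl (reedy_fibration cl fibB fibF) fibB.
Proof.
split.
- exact reedy_ttfc.
- exact base_ttfc.
- exact projection_ttf.
- intros A C f Hc Hf; apply (reedyE (X := self p A) (Y := self p C)).
  apply rfib_cartesian; [exact Hc|now rewrite bs_self].
- intros A C g J s t e Hg Hs.
  destruct (cl_factorP cl (above_self_eq e)) as [e1 e2]; apply above_bs in e2.
  apply (reedyE (X := self p A)).
  apply (rfib_cancel_cartesian (Z := self p C) (c := cl_lift cl t (self p C))).
  + apply (cl_cart cl t).
  + now rewrite e2.
  + rewrite e1; now apply reedyE.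
- intros A C f Hc Hf; apply (cartesian_acof_total (A' := self p A) (A := self p C) Hc).
  now rewrite bs_self.
Qed.

End ReedyFibrations.

Theorem mainTheorem3
  (E B : category) (p : functor E B) (cl : cleavage p)
  (fibB : morphism_class B)
  (fibF : forall I : B, morphism_class (fiber p I))
  (H1_base : is_ttfc fibB)
  (H1_fibers : forall I : B, is_ttfc (fibF I))
  (H2 : forall (I J : B) (s : I ~> J),
    type_theoretic_functor (fibF J) (fibF I) (reindex cl s))
  (H3 : forall (I J : B) (s : I ~> J), acyclic_cofibration fibB s ->
    forall (X Y : fiber p J) (f : X ~> Y), fibF J X Y f ->
      weakly_cartesian (reindex cl s) f)
  (ra : forall (I J : B) (s : I ~> J), fibB I J s -> right_adjoint (reindex cl s))
  (H4_fib : forall (I J : B) (s : I ~> J) (hs : fibB I J s)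
      (X Y : fiber p I) (f : X ~> Y),
    fibF I X Y f -> fibF J (ra I J s hs X) (ra I J s hs Y) (fmap (ra I J s hs) f))
  (H4_beck_chevalley : forall (I J I' J' : B) (s : I ~> J) (r : J' ~> J)
      (s' : I' ~> J') (t : I' ~> I)
      (sq : s ∘ t = r ∘ s') (hs : fibB I J s) (hs' : fibB I' J' s'),
    is_pullback t s' s r ->
    forall A : fiber p I,
      is_iso (beck_chevalley_map sq (ra I J s hs) (ra I' J' s' hs') A)) :
  is_ttfc (reedy_fibration cl fibB fibF) /\
  fibred_ttfc cl (reedy_fibration cl fibB fibF) fibB.
Proof.
split.
- exact (reedy_ttfc H1_base H1_fibers H2 H4_fib H4_beck_chevalley H3).
- exact (reedy_fibred_ttfc H1_base H1_fibers H2 H4_fib H4_beck_chevalley H3).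
Qed.
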